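(* For every real number $\beta$ with $0<\beta<1$ there exists a Cantor set $E\subset\partial\mathbb{B}^2$ whose polynomial hull $\hat E$ contains the closed ball $\overline{\beta\mathbb{B}^2}=\{z\in\mathbb{C}^2:|z|\le\beta\}$.
   Context: $\mathbb{B}^2$ is the open unit ball of $\mathbb{C}^2$ (Euclidean norm) and $\partial\mathbb{B}^2$ is the unit sphere. A Cantor set is a compact set homeomorphic to the middle-third Cantor set. For a compact set $K\subset\mathbb{C}^2$ the polynomial hull is $\hat K=\{z\in\mathbb{C}^2: |p(z)|\le\max_K|p| \text{ for all holomorphic polynomials } p\}$. *)

(* Defs.v *)
From HB Require Import structures.
From mathcomp Require Import all_boot all_order all_algebra.
From mathcomp Require Import complex.
(* Not imported: the notations of mpoly clash with those of the analysis
   library. *)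
From mathcomp Require mpoly.
From mathcomp Require Import all_classical all_reals all_analysis.
Set Implicit Arguments.
Unset Strict Implicit.
Unset Printing Implicit Defensive.
Import Order.TTheory GRing.Theory Num.Theory.
Import numFieldNormedType.Exports.
Local Open Scope classical_set_scope.
Local Open Scope ring_scope.

(* The complex numbers, packaged as a [numFieldType] so that they carry the
   topology that every [numFieldType] has (the bare type [R[i]] does not). *)
Definition Cplx (R : realType) : numFieldType := R[i].

(* The canonical norm [`|z|] on row vectors is the sup norm, hence this
   definition. *)
Definition enorm (R : realType) (z : 'rV[Cplx R]_2) : R :=
  Num.sqrt (\sum_(j < 2) ComplexField.Normc.normc (z 0 j) ^+ 2).

Definition unit_sphere (R : realType) : set 'rV[Cplx R]_2 :=
  [set z | enorm z = 1].

Arguments unit_sphere R : clear implicits.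

Definition closed_eball (R : realType) (r : R) : set 'rV[Cplx R]_2 :=
  [set z | enorm z <= r].

Definition peval (R : realType) (p : mpoly.mpoly 2 (Cplx R))
  (z : 'rV[Cplx R]_2) : Cplx R := mpoly.meval (z 0) p.

Definition is_max (R : realType) (A : set R) (m : R) : Prop :=
  A m /\ ubound A m.

(* For compact nonempty [K] the maximum exists and is unique; for empty [K]
   this gives the empty hull. *)
Definition poly_hull (R : realType) (K : set 'rV[Cplx R]_2) :
    set 'rV[Cplx R]_2 :=
  [set z | forall p : mpoly.mpoly 2 (Cplx R),
     exists2 m, is_max [set ComplexField.Normc.normc (peval p w) | w in K] m &
                ComplexField.Normc.normc (peval p z) <= m].

Fixpoint cantor_stage (R : realType) (n : nat) : set R :=
  if n is k.+1 then
    [set x / 3 | x in cantor_stage k] `|`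
    [set (x + 2) / 3 | x in cantor_stage k]
  else `[0, 1].

Definition middle_third_cantor (R : realType) : set R :=
  \bigcap_n cantor_stage n.

Arguments middle_third_cantor R : clear implicits.

Definition homeomorphic (S T : topologicalType) (A : set S) (B : set T) :
    Prop :=
  exists (f : S -> T) (g : T -> S),
    [/\ {within A, continuous f}, {within B, continuous g},
        {homo f : x / A x >-> B x}, {homo g : y / B y >-> A y} &
        (forall x, A x -> g (f x) = x) /\ (forall y, B y -> f (g y) = y)].

Definition cantor_set (R : realType) (E : set 'rV[Cplx R]_2) : Prop :=
  compact E /\ homeomorphic E (middle_third_cantor R).

(* Main.v *)
Require Import Defs.
From HB Require Import structures.
From mathcomp Require Import all_boot all_order all_algebra.
From mathcomp Require Import complex ring lra zify.
From mathcomp Require mpoly.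
From mathcomp Require Import all_classical all_reals all_analysis.
Set Implicit Arguments.
Unset Strict Implicit.
Unset Printing Implicit Defensive.
Import Order.TTheory GRing.Theory Num.Theory.
Import numFieldNormedType.Exports.
Local Open Scope classical_set_scope.
Local Open Scope ring_scope.

(** The boundary circle of a disc cut out of the ball by a complex line controls
    the polynomials on the disc, by the maximum principle; call it a slice. The
    Cantor set is the limit of unions of slices that become shorter and shorter.
    The difficulty is to keep its pieces disjoint although the slices in them are
    linked with each other, as in Antoine's necklace.

    The key fact is that few slices suffice. Fix a point [b] of the ball and the
    pencil of complex lines through [b]. The Taylor coefficient of order [m] of
    a polynomial at [b] is a polynomial of degree at most [m] in the slope of
    the line. If slopes are restricted to discs of radius [rho] around the roots
    of unity of order [2 ^ k], such a coefficient is still controlled up to the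
    factor [(4 / rho) ^ (m / 2 ^ k)] (lemma [coef_near_roots]), since the
    capacity of the union of these discs is about the root of order [2 ^ k] of
    [rho]. With [rho] exponentially small in [2 ^ k] the loss is geometric in
    [m], so the slices in question have a neighbourhood of [b] in their hull, of
    a size independent of [k] (lemma [pencil_hull]). On the other hand they are
    covered by balls whose squared radii have an arbitrarily small sum (lemma
    [tube_thin]). Finitely many such neighbourhoods show that a set whose points
    have a slice in [U], with some margin, is in the hull of a thin subset of
    [U] (lemma [thin_family]).

    Thin sets are easy to avoid: the lines through a given point that meet a
    thin set have a set of slopes of small area (lemma [unblocked_direction]).
    Hence pieces near prescribed points of the sphere can be chosen one after
    the other, each of them in the complement of the previous ones (lemma
    [disjoint_pieces]). Through the point [(1 - kap ^ 2) p] with [p] on the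
    sphere, the lines almost orthogonal to [p] have slices of size comparable to
    [kap] about [p]. So a set [K] whose hull contains a ball can be replaced by
    a disjoint union [K'] of small pieces near [K] whose hull contains
    [(1 - kap ^ 2) K], hence a slightly smaller ball (lemma
    [refinement_exists]).

    Iteration from the whole sphere gives sets converging to a compact set. Its
    hull contains the ball of radius [beta] because the hulls of all the
    approximations do. The separated small pieces make it totally disconnected,
    and it has no isolated point because each piece has a second one next to it. *)

(** * The absolute value with real values *)

Definition cnorm (R : realType) (x : Cplx R) : R := ComplexField.Normc.normc x.
Definition creal (R : realType) (x : R) : Cplx R := real_complex R x.

Definition cconj (R : realType) (x : Cplx R) : Cplx R := conjc x.

Section ComplexNorm.
Context {R : realType}.
Implicit Types x y : Cplx R.

Lemma cnorm0 : cnorm (0 : Cplx R) = 0.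
Proof. exact: ComplexField.Normc.normc0. Qed.

Lemma cnorm1 : cnorm (1 : Cplx R) = 1.
Proof. exact: ComplexField.Normc.normc1. Qed.

Lemma cnormM x y : cnorm (x * y) = cnorm x * cnorm y.
Proof. exact: ComplexField.Normc.normcM. Qed.

Lemma cnormD x y : cnorm (x + y) <= cnorm x + cnorm y.
Proof. exact: (@le_normcD R). Qed.

Lemma cnormN x : cnorm (- x) = cnorm x.
Proof. exact: (@normcN R). Qed.

Lemma cnormV x : cnorm x^-1 = (cnorm x)^-1.
Proof. exact: (@ComplexField.Normc.normcV R). Qed.

Lemma cnorm_ge0 x : 0 <= cnorm x.
Proof. by case: x => a b; exact: sqrtr_ge0. Qed.

Lemma cnorm_eq0 x : (cnorm x == 0) = (x == 0).
Proof.
apply/eqP/eqP => [/ComplexField.Normc.eq0_normc //|->]; exact: cnorm0.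
Qed.

Lemma cnorm_gt0 x : (0 < cnorm x) = (x != 0).
Proof. by rewrite lt_def cnorm_ge0 andbT cnorm_eq0. Qed.

Lemma cnormX x n : cnorm (x ^+ n) = cnorm x ^+ n.
Proof. by elim: n => [|n IH]; rewrite ?expr0 ?cnorm1 // !exprS cnormM IH. Qed.

Lemma cnormB x y : cnorm (x - y) = cnorm (y - x).
Proof. by rewrite -cnormN opprB. Qed.

Lemma cnorm_sum (I : Type) (r : seq I) (P : pred I) (F : I -> Cplx R) :
  cnorm (\sum_(i <- r | P i) F i) <= \sum_(i <- r | P i) cnorm (F i).
Proof.
elim/big_ind2 : _ => [|x a y b xa yb|//]; first by rewrite cnorm0.
exact: le_trans (cnormD _ _) (lerD _ _).
Qed.

Lemma cnorm_sqr x : cnorm x ^+ 2 = complex.Re x ^+ 2 + complex.Im x ^+ 2.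
Proof. by case: x => a b; rewrite sqr_sqrtr // addr_ge0 ?sqr_ge0. Qed.

Lemma cconjN x : cconj (- x) = - cconj x.
Proof. by case: x. Qed.

Lemma cconjK x : cconj (cconj x) = x.
Proof. by case: x => a b; rewrite /cconj /= opprK. Qed.

Lemma cnorm_conj x : cnorm (cconj x) = cnorm x.
Proof. by case: x => a b; rewrite /cnorm /= sqrrN. Qed.

Lemma cnorm_creal (a : R) : cnorm (creal a) = `|a|.
Proof. by rewrite /cnorm /creal /= expr0n addr0 sqrtr_sqr. Qed.

Lemma crealM (a b : R) : creal (a * b) = creal a * creal b.
Proof. exact: (rmorphM (real_complex R)). Qed.
Lemma crealD (a b : R) : creal (a + b) = creal a + creal b.
Proof. exact: (rmorphD (real_complex R)). Qed.
Lemma crealB (a b : R) : creal (a - b) = creal a - creal b.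
Proof. exact: (rmorphB (real_complex R)). Qed.
Lemma creal1 : creal 1 = 1 :> Cplx R.
Proof. by []. Qed.
Lemma creal0 : creal 0 = 0 :> Cplx R.
Proof. by []. Qed.
Lemma creal_eq0 (a : R) : (creal a == 0) = (a == 0).
Proof. by rewrite -cnorm_eq0 cnorm_creal normr_eq0. Qed.

Lemma csqrt x : exists w : Cplx R, w ^+ 2 = x.
Proof. by exists (sqrtc x); exact: (sqr_sqrtc x). Qed.

End ComplexNorm.

(** * Cauchy's estimate *)

Section CoefficientBounds.
Context {R : realType}.
Notation C := (Cplx R).
Implicit Types (q : {poly C}) (M : R).

(** The even and odd parts are half the sum and half the difference of the
    values at opposite points. *)
Lemma halves_le q (w : C) M :
  cnorm q.[w] <= M -> cnorm q.[- w] <= M ->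
  cnorm (even_poly q).[w ^+ 2] <= M /\
  cnorm w * cnorm (odd_poly q).[w ^+ 2] <= M.
Proof.
have two : cnorm (2 : C) = 2.
  by rewrite -(normr_nat R 2) -cnorm_creal /creal rmorph_nat.
have E t : q.[t] = (even_poly q).[t ^+ 2] + t * (odd_poly q).[t ^+ 2].
  rewrite -{1}(poly_even_odd q) hornerD hornerM !horner_comp hornerX !hornerXn.
  by rewrite mulrC.
move=> hp hn; have := E w; have := E (- w); rewrite sqrrN mulNr => en ep.
split.
  have e2 : 2 * (even_poly q).[w ^+ 2] = q.[w] + q.[- w] by rewrite ep en; ring.
  have := cnormD q.[w] q.[- w]; rewrite -e2 cnormM two => h.
  by lra.
have e2 : 2 * (w * (odd_poly q).[w ^+ 2]) = q.[w] - q.[- w] by rewrite ep en; ring.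
rewrite -cnormM.
have := cnormD q.[w] (- q.[- w]); rewrite -e2 cnormM two cnormN => h.
by lra.
Qed.

Lemma coef_even_odd q i :
  q`_i = if odd i then (odd_poly q)`_(i./2) else (even_poly q)`_(i./2).
Proof.
rewrite coef_odd_poly coef_even_poly.
case: ifP => oi; rewrite -[in LHS](odd_double_half i) oi; congr (q`_ _).
Qed.

(** Instead of integrating, pass to the even and odd parts: squaring maps the
    circle onto itself, so both have the same bound there, and half the size. *)
Lemma coef_unit_circle q M :
  (forall t : C, cnorm t = 1 -> cnorm q.[t] <= M) -> forall i, cnorm q`_i <= M.
Proof.
have [n] := ubnP (size q); elim: n q => // n IH q sq hq i.
have [sq1|sq1] := leqP (size q) 1.
  move: (hq 1 cnorm1); rewrite (size1_polyC sq1) hornerC coefC => h0.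
  by case: ifP => // _; rewrite cnorm0 (le_trans (cnorm_ge0 _) h0).
have hh (w : C) : cnorm w = 1 -> cnorm (even_poly q).[w ^+ 2] <= M /\
    cnorm (odd_poly q).[w ^+ 2] <= M.
  move=> w1.
  have w1' : cnorm (- w) = 1 by rewrite cnormN.
  by have [] := halves_le (hq w w1) (hq _ w1'); rewrite w1 mul1r.
have circle (t : C) : cnorm t = 1 -> exists2 w : C, cnorm w = 1 & w ^+ 2 = t.
  move=> t1; have [w wt] := csqrt t; exists w => //.
  have : cnorm w ^+ 2 = 1 by rewrite -cnormX wt.
  by move/eqP; rewrite sqrf_eq1 => /orP[/eqP//|/eqP w0]; have := cnorm_ge0 w;
    rewrite w0; lra.
rewrite coef_even_odd; case: ifP => _; apply: IH.
- apply: leq_ltn_trans (size_odd_poly _) _.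
  move: sq; rewrite ltnS; apply: leq_trans.
  by rewrite ltn_half_double -addnn -[X in (X < _)%N]addn0 ltn_add2l (ltn_trans _ sq1).
- by move=> t /circle[w /hh[_ +] <-].
- apply: leq_ltn_trans (size_even_poly _) _.
  move: sq; rewrite ltnS; apply: leq_trans.
  by rewrite ltn_uphalf_double; lia.
- by move=> t /circle[w /hh[+ _] <-].
Qed.

End CoefficientBounds.

(** * Polynomials near roots of unity *)

Section NearRoots.
Context {R : realType}.
Notation C := (Cplx R).
Implicit Types (q : {poly C}) (M rho : R).

Lemma horner_norm_le q n (b x : R) (t : C) :
  (size q <= n)%N -> (forall i, cnorm q`_i <= b) -> cnorm t <= x ->
  cnorm q.[t] <= b * \sum_(i < n) x ^+ i.
Proof.
move=> sq qb tx; rewrite (horner_coef_wide _ sq).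
apply: le_trans (cnorm_sum _ _ _) _; rewrite mulr_sumr; apply: ler_sum => i _.
rewrite cnormM cnormX; apply: ler_pM; rewrite ?cnorm_ge0 ?exprn_ge0 ?cnorm_ge0//.
by rewrite lerXn2r // nnegrE ?cnorm_ge0 // (le_trans (cnorm_ge0 t)).
Qed.

Lemma coef_circle q (r M : R) : 0 < r ->
  (forall t : C, cnorm t = r -> cnorm q.[t] <= M) ->
  forall i, cnorm q`_i * r ^+ i <= M.
Proof.
move=> r0 hq i; pose p : {poly C} := \poly_(i < size q) (q`_i * creal r ^+ i).
have pE t : p.[t] = q.[creal r * t].
  rewrite horner_poly horner_coef; apply: eq_bigr => j _.
  by rewrite exprMn mulrA.
have : cnorm p`_i <= M.
  apply: coef_unit_circle => t t1; rewrite pE; apply: hq.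
  by rewrite cnormM t1 cnorm_creal mulr1 gtr0_norm.
rewrite coef_poly; case: ltnP => [_|sq _].
  by rewrite cnormM cnormX cnorm_creal gtr0_norm.
rewrite nth_default // cnorm0 mul0r; apply: le_trans (cnorm_ge0 _) (hq (creal r) _).
by rewrite cnorm_creal gtr0_norm.
Qed.

Lemma geometric_sum_le (x : R) m : 1 <= x -> \sum_(i < m.+1) x ^+ i <= (2 * x) ^+ m.
Proof.
move=> x1; elim: m => [|m IH]; first by rewrite big_ord1 !expr0.
rewrite big_ord_recr /=; apply: le_trans (lerD IH (lexx _)) _.
have h2 : 1 <= (2 : R) ^+ m by apply: exprn_ege1; lra.
have hx : x ^+ m <= x ^+ m.+1 by rewrite exprS ler_peMl // exprn_ge0; lra.
have hx0 : 0 <= x ^+ m.+1 by rewrite exprn_ge0 //; lra.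
rewrite !exprMn (exprS 2).
have : 2 ^+ m * x ^+ m <= 2 ^+ m * x ^+ m.+1 by rewrite ler_wpM2l //; lra.
nra.
Qed.

(** Recentring at [1] bounds the polynomial on the unit circle, and thereby its
    coefficients at [0]. *)
Lemma coef_disc rho M q m : 0 < rho <= 1/2 -> (size q <= m.+1)%N ->
  (forall w : C, cnorm (w - 1) <= rho -> cnorm q.[w] <= M) ->
  forall i, cnorm q`_i <= M * (4 / rho) ^+ m.
Proof.
move=> /andP[r0 r1] sq hq; have rn0 : creal rho != 0 by rewrite creal_eq0 gt_eqF.
pose a : {poly C} := 1 + (creal rho) *: 'X.
have ha s : a.[s] = 1 + creal rho * s by rewrite /a !hornerE.
have sa : size a = 2%N.
  by rewrite /a addrC size_polyDl ?size_poly1 size_scale // size_polyX.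
pose r := q \Po a.
have sr : (size r <= m.+1)%N by rewrite size_comp_poly2.
have rM i : cnorm r`_i <= M.
  apply: coef_unit_circle => t t1; rewrite horner_comp; apply: hq.
  by rewrite ha addrAC subrr add0r cnormM t1 cnorm_creal mulr1 gtr0_norm.
have M0 : 0 <= M by exact: le_trans (cnorm_ge0 _) (rM 0%N).
apply: coef_unit_circle => w w1.
have -> : q.[w] = r.[(w - 1) / creal rho].
  rewrite horner_comp ha; congr (q.[_]); field; exact: rn0.
apply: le_trans (horner_norm_le (x := 2 / rho) sr rM _) _.
  rewrite cnormM cnormV cnorm_creal (gtr0_norm r0) ler_pM2r ?invr_gt0 //.
  by have := cnormD w (- 1); rewrite cnormN w1 cnorm1.
rewrite ler_wpM2l //.
have x1 : 1 <= 2 / rho by rewrite ler_pdivlMr //; lra.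
by have := geometric_sum_le m x1; rewrite mulrA; congr (_ <= (_ / _) ^+ _); lra.
Qed.

(** The capacity of the region [cnorm (w ^+ (2 ^ k) - 1) <= rho] is the root of
    order [2 ^ k] of [rho], and tends to that of the unit disc as [k] grows.
    This region is the preimage under squaring of the one for [k - 1], so that
    passing to the even and odd parts reduces [k] by one and halves the degree;
    what remains is a disc of radius [rho]. *)
Lemma coef_near_roots k : forall rho M q m, 0 < rho <= 1/2 -> (size q <= m.+1)%N ->
  (forall w : C, cnorm (w ^+ (2 ^ k) - 1) <= rho -> cnorm q.[w] <= M) ->
  forall i, cnorm q`_i <= 2 ^+ k * M * (4 / rho) ^+ (m %/ 2 ^ k)%N.
Proof.
elim: k => [|k IH] rho M q m r01 sq hq i.
  by rewrite expr0 mul1r expn0 divn1; apply: coef_disc.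
have N0 : (0 < 2 ^ k)%N by rewrite expn_gt0.
have sqE x : exists w : C, [/\ w ^+ 2 = x & cnorm (x ^+ (2 ^ k) - 1) <= rho ->
    [/\ cnorm q.[w] <= M, cnorm q.[- w] <= M & 1/2 <= cnorm w]].
  have [w wx] := csqrt x; exists w; split=> // hx.
  have wN : w ^+ (2 ^ k.+1) = x ^+ (2 ^ k) by rewrite expnS exprM wx.
  split; first by apply: hq; rewrite wN.
    by apply: hq; rewrite expnS exprM sqrrN wx.
  rewrite leNgt; apply/negP => hw.
  have h1 : cnorm (w ^+ (2 ^ k.+1)) <= cnorm w.
    rewrite cnormX; case: (2 ^ k.+1)%N (expn_gt0 2 k.+1) => // n _.
    by rewrite exprS ler_piMr ?cnorm_ge0 // exprn_ile1 ?cnorm_ge0 //; lra.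
  have := cnormD (w ^+ (2 ^ k.+1)) (1 - w ^+ (2 ^ k.+1)).
  by rewrite addrC subrK cnorm1 (cnormB 1) wN; rewrite wN in h1; lra.
have M0 : 0 <= M.
  apply: le_trans (cnorm_ge0 q.[1]) (hq 1 _).
  by rewrite expr1n subrr cnorm0; lra.
have mE : (m %/ 2 ^ k.+1 = m./2 %/ 2 ^ k)%N by rewrite expnS divnMA divn2.
rewrite coef_even_odd mE; case: ifP => _.
- have -> : 2 ^+ k.+1 * M = 2 ^+ k * (2 * M) by rewrite exprS; ring.
  apply: (IH rho) => // [|x hx].
    by apply: leq_trans (size_odd_poly _) _; lia.
  have [w [wx /(_ hx)[qw qw' w2]]] := sqE x; rewrite -wx.
  have [_ h] := halves_le qw qw'; have := cnorm_ge0 (odd_poly q).[w ^+ 2]; nra.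
- have c0 : 0 <= 2 ^+ k * M * (4 / rho) ^+ (m./2 %/ 2 ^ k).
    by rewrite !mulr_ge0 ?exprn_ge0 // mulr_ge0 ?invr_ge0 //; lra.
  have h2 : 2 ^+ k.+1 * M * (4 / rho) ^+ (m./2 %/ 2 ^ k) =
       2 * (2 ^+ k * M * (4 / rho) ^+ (m./2 %/ 2 ^ k)) by rewrite exprS; ring.
  rewrite h2.
  suff : cnorm (even_poly q)`_i./2 <= 2 ^+ k * M * (4 / rho) ^+ (m./2 %/ 2 ^ k).
    by move: c0; lra.
  apply: (IH rho) => // [|x hx].
    by apply: leq_trans (size_even_poly _) _; lia.
  have [w [wx /(_ hx)[qw qw' w2]]] := sqE x; rewrite -wx.
  by have [] := halves_le qw qw'.
Qed.

(** If [M < x], then the powers of [x / M] are unbounded. *)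
Lemma tensor_power (Q x M : R) : 0 <= x -> 0 <= M ->
  (forall n, x ^+ n <= Q * M ^+ n) -> x <= M.
Proof.
move=> x0 M0 h; rewrite leNgt; apply/negP => Mx.
have {x0} x0 : 0 < x by lra.
pose r := M / x.
have r1 : `|r| < 1 by rewrite ger0_norm ?divr_ge0 // ?ltr_pdivrMr //; lra.
have Q0 : 0 < Q by have := h 0%N; rewrite !expr0; lra.
have := @cvg_expr R r r1 => /cvgrPdist_lt /(_ Q^-1).
rewrite invr_gt0 => /(_ Q0) [n _ /(_ n (leqnn n)) /=].
rewrite sub0r normrN ger0_norm; last by rewrite exprn_ge0 // divr_ge0 //; lra.
rewrite /r expr_div_n ltr_pdivrMr ?exprn_gt0 // mulrC ltr_pdivlMr //.
by have := h n; rewrite mulrC; lra.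
Qed.

(** The maximum principle up to a constant, from the power series at the
    centre. *)
Lemma disc_bound q (c : C) (r rr M : R) : 0 < r -> rr < r ->
  (forall t, cnorm (t - c) = r -> cnorm q.[t] <= M) ->
  forall t, cnorm (t - c) <= rr -> cnorm q.[t] <= (1 - rr / r)^-1 * M.
Proof.
move=> r0 rrr hq t ht.
have rn0 : creal r != 0 by rewrite creal_eq0 gt_eqF.
pose a : {poly C} := c%:P + (creal r) *: 'X.
have ha s : a.[s] = c + creal r * s by rewrite /a !hornerE.
pose p := q \Po a.
have pM i : cnorm p`_i <= M.
  apply: coef_unit_circle => s s1; rewrite horner_comp; apply: hq.
  by rewrite ha addrAC subrr add0r cnormM s1 cnorm_creal mulr1 gtr0_norm.
have M0 : 0 <= M by exact: le_trans (cnorm_ge0 _) (pM 0%N).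
have -> : q.[t] = p.[(t - c) / creal r].
  rewrite horner_comp ha; congr (q.[_]); field; exact: rn0.
have rr0 : 0 <= rr by exact: le_trans (cnorm_ge0 _) ht.
have x1 : rr / r < 1 by rewrite ltr_pdivrMr //; lra.
apply: le_trans (horner_norm_le (x := rr / r) (leqnn _) pM _) _.
  by rewrite cnormM cnormV cnorm_creal (gtr0_norm r0) ler_pM2r ?invr_gt0.
rewrite mulrC ler_wpM2r //.
have d0 : 0 < 1 - rr / r by lra.
rewrite -[leRHS]mul1r ler_pdivlMr //.
elim: (size p) => [|n _]; first by rewrite big_ord0 mul0r.
rewrite -opprB mulrN mulrC -subrX1 opprB lerBlDr lerDl exprn_ge0 // divr_ge0 //.
exact: ltW.
Qed.

(** The constant of [disc_bound] disappears by [tensor_power]. *)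
Lemma maximum_principle q (c : C) (r M : R) : 0 < r ->
  (forall t, cnorm (t - c) = r -> cnorm q.[t] <= M) ->
  forall t, cnorm (t - c) <= r -> cnorm q.[t] <= M.
Proof.
move=> r0 hq t; rewrite le_eqVlt => /orP[/eqP|tr]; first exact: hq.
have M0 : 0 <= M.
  apply: le_trans (cnorm_ge0 _) (hq (c + creal r) _).
  by rewrite addrAC subrr add0r cnorm_creal gtr0_norm.
apply: (@tensor_power (1 - cnorm (t - c) / r)^-1) => //; first exact: cnorm_ge0.
move=> n; rewrite -cnormX -horner_exp; apply: (disc_bound r0 tr) (lexx _).
move=> s /hq hs; rewrite horner_exp cnormX lerXn2r // nnegrE //; exact: cnorm_ge0.
Qed.

End NearRoots.

(** * Hermitian geometry of the plane *)

Section EuclideanPlane.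
Context {R : realType}.
Notation C := (Cplx R).
Notation V := 'rV[Cplx R]_2.
Implicit Types (z w b v : V).

Lemma ord2P (j : 'I_2) : j = 0 \/ j = 1.
Proof.
case: j => [[|[|//]]] h; [left|right]; exact: val_inj.
Qed.

Lemma rV2P z w : z 0 0 = w 0 0 -> z 0 1 = w 0 1 -> z = w.
Proof. by move=> h0 h1; apply/rowP => j; case: (ord2P j) => ->. Qed.

Lemma enorm_sqr z : enorm z ^+ 2 = cnorm (z 0 0) ^+ 2 + cnorm (z 0 1) ^+ 2.
Proof.
rewrite /enorm sqr_sqrtr; last by apply: sumr_ge0 => i _; rewrite sqr_ge0.
rewrite !big_ord_recl big_ord0 addr0; congr (_ + cnorm (z 0 _) ^+ 2).
exact: val_inj.
Qed.

Lemma enorm_ge0 z : 0 <= enorm z.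
Proof. exact: sqrtr_ge0. Qed.

Lemma enorm_le z (r : R) : 0 <= r ->
  (enorm z <= r) = (cnorm (z 0 0) ^+ 2 + cnorm (z 0 1) ^+ 2 <= r ^+ 2).
Proof. by move=> r0; rewrite -enorm_sqr ler_pXn2r // nnegrE enorm_ge0. Qed.

Lemma coord_le z j : cnorm (z 0 j) <= enorm z.
Proof.
rewrite -(@ler_pXn2r _ 2) // ?nnegrE ?cnorm_ge0 ?enorm_ge0 // enorm_sqr.
by case: (ord2P j) => ->; rewrite ?lerDl ?lerDr ?sqr_ge0.
Qed.

Lemma enorm0 : enorm (0 : V) = 0.
Proof.
apply/eqP; rewrite -sqrf_eq0 enorm_sqr !mxE cnorm0 expr0n addr0 //.
Qed.

Lemma enorm_eq0 z : (enorm z == 0) = (z == 0).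
Proof.
apply/eqP/eqP => [h|->]; last exact: enorm0.
by apply: rV2P; rewrite mxE; apply/eqP; rewrite -cnorm_eq0 eq_le;
  apply/andP; split; rewrite ?cnorm_ge0 // -h coord_le.
Qed.

Lemma enormZ (a : C) z : enorm (a *: z) = cnorm a * enorm z.
Proof.
apply/eqP; rewrite -(@eqrXn2 _ 2) ?mulr_ge0 ?cnorm_ge0 ?enorm_ge0 //.
by rewrite exprMn !enorm_sqr !mxE !cnormM !exprMn mulrDr.
Qed.

Lemma enormN z : enorm (- z) = enorm z.
Proof. by rewrite -scaleN1r enormZ cnormN cnorm1 mul1r. Qed.

Lemma enormB z w : enorm (z - w) = enorm (w - z).
Proof. by rewrite -enormN opprB. Qed.

Lemma enormD z w : enorm (z + w) <= enorm z + enorm w.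
Proof.
have [z0 w0] := (enorm_ge0 z, enorm_ge0 w).
rewrite enorm_le ?addr_ge0 // !mxE.
have := enorm_sqr z; have := enorm_sqr w.
have := cnormD (z 0 0) (w 0 0); have := cnormD (z 0 1) (w 0 1).
have := cnorm_ge0 (z 0 0 + w 0 0); have := cnorm_ge0 (z 0 1 + w 0 1).
have := cnorm_ge0 (z 0 0); have := cnorm_ge0 (z 0 1).
have := cnorm_ge0 (w 0 0); have := cnorm_ge0 (w 0 1).
move: (cnorm (z 0 0 + w 0 0)) (cnorm (z 0 1 + w 0 1)) => s0 s1.
move: (cnorm (w 0 1)) (cnorm (w 0 0)) (cnorm (z 0 1)) (cnorm (z 0 0)).
move: (enorm z) (enorm w) z0 w0 => a b a0 b0.
move=> w1 w0' z1 z0' h1 h2 h3 h4 h5 h6 s1le s0le eb ea.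
have cs : z0' * w0' + z1 * w1 <= a * b.
  rewrite -(@ler_pXn2r _ 2) // ?nnegrE ?mulr_ge0 //; last by rewrite addr_ge0 ?mulr_ge0.
  rewrite exprMn ea eb -subr_ge0.
  have -> : (z0' ^+ 2 + z1 ^+ 2) * (w0' ^+ 2 + w1 ^+ 2) -
    (z0' * w0' + z1 * w1) ^+ 2 = (z0' * w1 - z1 * w0') ^+ 2 by ring.
  exact: sqr_ge0.
have q0 : s0 ^+ 2 <= (z0' + w0') ^+ 2 by rewrite lerXn2r // nnegrE addr_ge0.
have q1 : s1 ^+ 2 <= (z1 + w1) ^+ 2 by rewrite lerXn2r // nnegrE addr_ge0.
rewrite !expr2 in q0 q1 ea eb *; nra.
Qed.

Lemma enorm_triangle z w b : enorm (z - b) <= enorm (z - w) + enorm (w - b).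
Proof. by have := enormD (z - w) (w - b); rewrite addrA subrK. Qed.

Lemma enorm_le_sum z : enorm z <= cnorm (z 0 0) + cnorm (z 0 1).
Proof.
rewrite enorm_le ?addr_ge0 ?cnorm_ge0 // sqrrD -addrA lerD2l lerDr.
by rewrite mulrn_wge0 // mulr_ge0 ?cnorm_ge0.
Qed.

Lemma mulc_conj (x : C) : x * (cconj x) = creal (cnorm x ^+ 2).
Proof.
have -> : creal (cnorm x ^+ 2) = creal (cnorm x) ^+ 2 by rewrite expr2 crealM.
by have := @sqr_normc R x; rewrite /creal /cnorm => <-; case: x.
Qed.

Definition ip z v : C := z 0 0 * cconj (v 0 0) + z 0 1 * cconj (v 0 1).

(** For a unit vector [v], the vectors [v] and [perp v] form a unitary frame. *)
Definition perp v : V := \row_(j < 2) if j == 0 then - cconj (v 0 1) else cconj (v 0 0).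

Lemma perp0 v : perp v 0 0 = - (cconj (v 0 1)).
Proof. by rewrite mxE. Qed.
Lemma perp1 v : perp v 0 1 = cconj (v 0 0).
Proof. by rewrite mxE. Qed.

Lemma ipB z w v : ip (z - w) v = ip z v - ip w v.
Proof. by rewrite /ip !mxE; ring. Qed.
Lemma ipD z w v : ip (z + w) v = ip z v + ip w v.
Proof. by rewrite /ip !mxE; ring. Qed.
Lemma ipZ (a : C) w v : ip (a *: w) v = a * ip w v.
Proof. by rewrite /ip !mxE; ring. Qed.

Lemma enorm_frame v (x y : C) : enorm v = 1 ->
  enorm (x *: v + y *: perp v) ^+ 2 = cnorm x ^+ 2 + cnorm y ^+ 2.
Proof.
move=> v1; have := enorm_sqr v; rewrite v1 expr1n enorm_sqr !mxE /= !cnorm_sqr.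
case: (v 0 0) (v 0 1) x y => [a b] [c d] [e f] [g h] /= hv.
rewrite -[e ^+ 2 + f ^+ 2]mulr1 -[g ^+ 2 + h ^+ 2]mulr1 hv; ring.
Qed.

Lemma ip_self v : enorm v = 1 -> ip v v = 1.
Proof.
move=> v1; rewrite /ip !mulc_conj -crealD -enorm_sqr v1 expr1n //.
Qed.

Lemma ip_perp_self v : ip (perp v) v = 0.
Proof. by rewrite /ip perp0 perp1; ring. Qed.

Lemma ip_self_perp v : ip v (perp v) = 0.
Proof. by rewrite /ip perp0 perp1 cconjN !cconjK; ring. Qed.

Lemma enorm_perp v : enorm (perp v) = enorm v.
Proof.
apply/eqP; rewrite -(@eqrXn2 _ 2) ?enorm_ge0 //.
by rewrite !enorm_sqr perp0 perp1 cnormN !cnorm_conj addrC.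
Qed.

Lemma frame_eq v z : enorm v = 1 -> z = ip z v *: v + ip z (perp v) *: perp v.
Proof.
move=> v1; have v1' : (v 0 0) * (cconj (v 0 0)) + (v 0 1) * (cconj (v 0 1)) = 1.
  exact: ip_self.
apply: rV2P; rewrite /ip !mxE /= cconjN !cconjK.
  by rewrite -[LHS]mulr1 -v1'; ring.
by rewrite -[LHS]mulr1 -v1'; ring.
Qed.

Lemma ip_le z v : enorm v = 1 -> cnorm (ip z v) <= enorm z.
Proof.
move=> v1; rewrite -(@ler_pXn2r _ 2) // ?nnegrE ?cnorm_ge0 ?enorm_ge0 //.
by rewrite {2}(frame_eq z v1) enorm_frame // lerDl sqr_ge0.
Qed.

(** Completing the square: on a complex line the squared norm is, up to a
    constant, the squared distance to a point of the line. *)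
Lemma line_norm b v : v != 0 -> exists c : C, exists2 kap : R,
  kap <= enorm b ^+ 2 &
  forall t : C, enorm (b + t *: v) ^+ 2 = enorm v ^+ 2 * cnorm (t - c) ^+ 2 + kap.
Proof.
move=> v0; pose n := enorm v ^+ 2.
have n0 : 0 < n by rewrite exprn_gt0 // lt_def enorm_eq0 v0 enorm_ge0.
have cn0 : creal n != 0 by rewrite creal_eq0 gt_eqF.
pose c : C := - ip b v / creal n; exists c; exists (enorm b ^+ 2 - n * cnorm c ^+ 2).
  by rewrite gerBl mulr_ge0 ?sqr_ge0 // ltW.
have hc : creal n * c = - ip b v by rewrite mulrC mulfVK.
move=> t; rewrite -/n; move: (enorm_sqr v) hc; rewrite -/n /ip !enorm_sqr !mxE !cnorm_sqr.
case: (v 0 0) (v 0 1) (b 0 0) (b 0 1) t c => [a1 a2] [a3 a4] [b1 b2] [b3 b4] [t1 t2] [c1 c2].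
move=> /= hn hc.
have E1 : n * c1 - 0 * c2 = - ((b1 * a1 - b2 * - a2) + (b3 * a3 - b4 * - a4)).
  by have /= := congr1 (@complex.Re R) hc.
have E2 : n * c2 + 0 * c1 = - ((b1 * - a2 + b2 * a1) + (b3 * - a4 + b4 * a3)).
  by have /= := congr1 (@complex.Im R) hc.
rewrite mul0r subr0 in E1; rewrite mul0r addr0 in E2.
have -> : n * ((t1 - c1) ^+ 2 + (t2 - c2) ^+ 2) =
  n * (t1 ^+ 2 + t2 ^+ 2) - 2 * t1 * (n * c1) - 2 * t2 * (n * c2)
   + n * (c1 ^+ 2 + c2 ^+ 2) by ring.
rewrite E1 E2 {1}hn; ring.
Qed.

End EuclideanPlane.

(** * Polynomial functions and hulls *)

(** Polynomial functions as an inductive class, for which stability under affine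
    substitutions and restriction to lines are proved by induction. *)
Inductive polyfun (R : realType) : ('rV[Cplx R]_2 -> Cplx R) -> Prop :=
| polyfun_const c : polyfun (fun=> c)
| polyfun_coord j : polyfun (fun z => z 0 j)
| polyfun_add f g : polyfun f -> polyfun g -> polyfun (fun z => f z + g z)
| polyfun_mul f g : polyfun f -> polyfun g -> polyfun (fun z => f z * g z).

(** The polynomial hull in terms of bounds instead of maxima, which makes sense
    for arbitrary sets [G]. *)
Definition hull_at (R : realType) (G : set 'rV[Cplx R]_2) (z : 'rV[Cplx R]_2) :=
  forall f, polyfun f -> forall M : R,
    (forall w, G w -> cnorm (f w) <= M) -> cnorm (f z) <= M.

Definition slice (R : realType) (b v : 'rV[Cplx R]_2) : set 'rV[Cplx R]_2 :=
  [set z | enorm z = 1 /\ exists t : Cplx R, z = b + t *: v].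

Section PolynomialFunctions.
Context {R : realType}.
Notation C := (Cplx R).
Notation V := 'rV[Cplx R]_2.
Implicit Types (z w b v u : V) (f : V -> C) (M : R).

Lemma polyfun_exp f n : polyfun f -> polyfun (fun z => f z ^+ n).
Proof.
move=> pf; elim: n => [|n IH].
  by under [X in polyfun X]eq_fun do rewrite expr0; exact: polyfun_const.
by under [X in polyfun X]eq_fun do rewrite exprS; exact: polyfun_mul.
Qed.

Lemma polyfun_sum (I : Type) (r : seq I) (F : I -> V -> C) :
  (forall i, polyfun (F i)) -> polyfun (fun z => \sum_(i <- r) F i z).
Proof.
move=> pF; elim: r => [|i r IH].
  by under [X in polyfun X]eq_fun do rewrite big_nil; exact: polyfun_const.
by under [X in polyfun X]eq_fun do rewrite big_cons; exact: polyfun_add.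
Qed.

Lemma polyfun_prod (I : Type) (r : seq I) (F : I -> V -> C) :
  (forall i, polyfun (F i)) -> polyfun (fun z => \prod_(i <- r) F i z).
Proof.
move=> pF; elim: r => [|i r IH].
  by under [X in polyfun X]eq_fun do rewrite big_nil; exact: polyfun_const.
by under [X in polyfun X]eq_fun do rewrite big_cons; exact: polyfun_mul.
Qed.

Lemma polyfun_peval (p : mpoly.mpoly 2 C) : polyfun (peval p).
Proof.
have -> : peval p = fun z => \sum_(m <- mpoly.msupp p)
    mpoly.mcoeff m p * \prod_(i <- index_enum 'I_2) z 0 i ^+ mpoly.fun_of_multinom m i.
  by apply/funext => z; rewrite /peval mpoly.mevalE.
apply: polyfun_sum => m; apply: polyfun_mul; first exact: polyfun_const.
by apply: polyfun_prod => i; apply: polyfun_exp; exact: polyfun_coord.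
Qed.

Lemma polyfun_affine f b (a : C) : polyfun f -> polyfun (fun z => f (b + a *: z)).
Proof.
elim=> {f} [c|j|f g _ IHf _ IHg|f g _ IHf _ IHg].
- exact: polyfun_const.
- under [X in polyfun X]eq_fun do rewrite mxE [X in _ + X]mxE.
  apply: polyfun_add; first exact: polyfun_const.
  by apply: polyfun_mul; [exact: polyfun_const | exact: polyfun_coord].
- exact: polyfun_add.
- exact: polyfun_mul.
Qed.

Lemma polyfun_line f b v : polyfun f ->
  exists q : {poly C}, forall t, f (b + t *: v) = q.[t].
Proof.
elim=> {f} [c|j|f g _ [p hp] _ [q hq]|f g _ [p hp] _ [q hq]].
- by exists c%:P => t; rewrite hornerC.
- by exists ((b 0 j)%:P + (v 0 j) *: 'X) => t; rewrite !mxE !hornerE mulrC.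
- by exists (p + q) => t; rewrite hornerD hp hq.
- by exists (p * q) => t; rewrite hornerM hp hq.
Qed.

(** On the pencil of lines through [b] the Taylor coefficient of order [m] is a
    polynomial of degree at most [m] in the slope [w]. *)
Lemma polyfun_pencil f b v u : polyfun f -> exists2 Z : {poly {poly C}},
  (forall m, (size (Z`_m)%R <= m.+1)%N) &
  forall t w : C, f (b + t *: (v + w *: u)) = (map_poly (horner_eval w) Z).[t].
Proof.
elim=> {f} [c|j|f g _ [p sp hp] _ [q sq hq]|f g _ [p sp hp] _ [q sq hq]].
- exists c%:P%:P => [m|t w].
    rewrite coefC; case: ifP => _; last by rewrite size_poly0.
    by rewrite (leq_trans (size_polyC_leq1 _)).
  by rewrite map_polyC hornerC /= /horner_eval hornerC.
- exists ((b 0 j)%:P%:P + ((v 0 j)%:P + (u 0 j) *: 'X) *: 'X) => [m|t w].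
    rewrite coefD coefC coefZ coefX; case: m => [|[|m]] /=.
    + by rewrite mulr0 addr0 size_polyC_leq1.
    + rewrite mulr1 add0r (leq_trans (size_polyD _ _)) // geq_max.
      rewrite (leq_trans (size_polyC_leq1 _)) //=.
      by rewrite (leq_trans (size_scale_leq _ _)) ?size_polyX.
    + by rewrite mulr0 addr0 size_poly0.
  rewrite !mxE rmorphD /= map_polyC map_polyZ map_polyX /= /horner_eval !hornerE.
  by ring.
- exists (p + q) => [m|t w].
    by rewrite coefD (leq_trans (size_polyD _ _)) // geq_max sp sq.
  by rewrite rmorphD hornerD hp hq.
- exists (p * q) => [m|t w]; last by rewrite rmorphM hornerM hp hq.
  rewrite coefM; apply: (leq_trans (size_sum _ _ _)); apply/bigmax_leqP => i _.
  apply: leq_trans (size_polyMleq _ _) _.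
  have := leq_add (sp i) (sq (m - i)%N); have := ltn_ord i; lia.
Qed.

Lemma hull_at_sub (G G' : set V) z : G `<=` G' -> hull_at G z -> hull_at G' z.
Proof. by move=> s h f pf M hM; apply: (h _ pf) => w /s; exact: hM. Qed.

(** Membership in the hull follows from an estimate with a constant. *)
Lemma hull_at_const (Q : R) (G : set V) z : G !=set0 ->
  (forall f, polyfun f -> forall M,
    (forall w, G w -> cnorm (f w) <= M) -> cnorm (f z) <= Q * M) -> hull_at G z.
Proof.
move=> [w0 Gw0] h f pf M hM.
have M0 : 0 <= M by exact: le_trans (cnorm_ge0 _) (hM _ Gw0).
apply: (@tensor_power _ Q) => //; first exact: cnorm_ge0.
move=> n; rewrite -cnormX; apply: (h _ (polyfun_exp n pf)) => w /hM hw.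
by rewrite cnormX lerXn2r // nnegrE cnorm_ge0.
Qed.

Lemma slice_circle b v : v != 0 -> enorm b < 1 -> exists c : C, exists r : R,
  [/\ 0 < r, 1 - enorm b ^+ 2 <= enorm v ^+ 2 * r ^+ 2 <= 1 &
      forall t : C, enorm (b + t *: v) ^+ 2 - 1 =
                    enorm v ^+ 2 * (cnorm (t - c) ^+ 2 - r ^+ 2)].
Proof.
move=> v0 b1; have [c [kap kb E]] := line_norm b v0.
have n0 : 0 < enorm v by rewrite lt_def enorm_eq0 v0 enorm_ge0.
have k1 : 0 < 1 - kap.
  by have : enorm b ^+ 2 < 1 by [rewrite expr_lt1 ?enorm_ge0]; lra.
pose r := Num.sqrt ((1 - kap) / enorm v ^+ 2).
have r2 : enorm v ^+ 2 * r ^+ 2 = 1 - kap.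
  rewrite [r ^+ 2]sqr_sqrtr; last by rewrite divr_ge0 ?sqr_ge0 // ltW.
  by rewrite mulrC mulfVK // sqrf_eq0 gt_eqF.
have kap0 : 0 <= kap.
  have := E c; rewrite subrr cnorm0 expr0n mulr0 add0r => <-; exact: sqr_ge0.
exists c, r; split.
- by rewrite sqrtr_gt0 divr_gt0 // exprn_gt0.
- by rewrite r2; apply/andP; split; lra.
- by move=> t; rewrite E mulrBr r2; ring.
Qed.

(** The maximum principle on the disc bounded by a slice. *)
Lemma slice_max b v f M : polyfun f -> v != 0 -> enorm b < 1 ->
  (forall z, slice b v z -> cnorm (f z) <= M) ->
  forall t : C, enorm (b + t *: v) <= 1 -> cnorm (f (b + t *: v)) <= M.
Proof.
move=> pf v0 b1 hM t ht.
have [c [r [r0 _ E]]] := slice_circle v0 b1; have [q hq] := polyfun_line b v pf.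
have n0 : 0 < enorm v by rewrite lt_def enorm_eq0 v0 enorm_ge0.
rewrite hq; apply: (maximum_principle r0 (c := c)) => [s hs|].
  rewrite -hq; apply: hM; split; last by exists s.
  apply/eqP; rewrite -(@eqrXn2 _ 2) ?enorm_ge0 // expr1n -subr_eq0 E hs subrr mulr0 //.
rewrite -(@ler_pXn2r _ 2) // ?nnegrE ?cnorm_ge0 ?(ltW r0) // -subr_le0.
rewrite -(pmulr_rle0 _ (exprn_gt0 2 n0)) -E subr_le0.
by rewrite expr_le1 // enorm_ge0.
Qed.

Lemma near_root_le k (w : C) : cnorm (w ^+ (2 ^ k) - 1) <= 1/2 -> cnorm w <= 2.
Proof.
move=> h; rewrite leNgt; apply/negP => w2.
have := cnormD (w ^+ (2 ^ k) - 1) 1; rewrite subrK cnorm1 cnormX => h1.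
have : cnorm w <= cnorm w ^+ (2 ^ k).
  case: (2 ^ k)%N (expn_gt0 2 k) => // n _; rewrite exprS ler_peMr ?cnorm_ge0 //.
  by apply: exprn_ege1; lra.
by lra.
Qed.

(** The smallest radius for which the factor [(4 / root_radius k) ^ (m / 2 ^ k)]
    of [coef_near_roots] is at most [2 ^ m]. *)
Definition root_radius k : R := 4 / 2 ^+ (2 ^ k).

Lemma root_radius_gt0 k : 0 < root_radius k.
Proof. by rewrite divr_gt0 // exprn_gt0. Qed.

Lemma root_radius_le k : (3 <= k)%N -> root_radius k <= 1/2.
Proof.
move=> k3; rewrite /root_radius ler_pdivrMr ?exprn_gt0 //.
have : (2 : R) ^+ 8 <= 2 ^+ (2 ^ k).
  by rewrite ler_weXn2l // ?ler1n // -[8%N]/(2 ^ 3)%N leq_exp2l.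
have -> : (2 : R) ^+ 8 = 256 by ring.
by lra.
Qed.

(** The discs through [b] whose slopes lie near the roots of unity of order
    [2 ^ k] already have a neighbourhood of [b] in their hull, and the size of
    this neighbourhood does not depend on [k]. *)
Lemma pencil_hull b v u k (tau : R) (G : set V) : (3 <= k)%N -> 0 < tau ->
  (forall w : C, cnorm w <= 2 -> v + w *: u != 0 /\ enorm (v + w *: u) <= 2) ->
  enorm b + 2 * tau < 1 -> G !=set0 ->
  (forall w : C, cnorm (w ^+ (2 ^ k) - 1) <= root_radius k ->
     slice b (v + w *: u) `<=` G) ->
  forall x y : C, cnorm x <= tau / 8 -> cnorm y <= tau / 8 ->
    hull_at G (b + x *: v + y *: u).
Proof.
move=> k3 t0 hvu b1 G0 hG.
have r0 : 0 < tau / 8 by lra.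
have rk : 0 < root_radius k <= 1/2 by rewrite root_radius_gt0 root_radius_le.
(* On the circle [cnorm x = tau / 8] the slope [y / x] is bounded by 1, and the
   Taylor series at [b] is dominated by a geometric series. *)
have core (t w : C) : cnorm t = tau / 8 -> cnorm w <= 1 ->
    hull_at G (b + t *: (v + w *: u)).
  move=> ht hw; apply: (@hull_at_const (2 * 2 ^+ k)) => // f pf M hM.
  have M0 : 0 <= M by have [w0 /hM] := G0; apply: le_trans (cnorm_ge0 _).
  have [Z sZ hZ] := polyfun_pencil b v u pf.
  have Zw m (s : C) : cnorm (s ^+ (2 ^ k) - 1) <= root_radius k ->
      cnorm ((Z`_m).[s]) <= M / tau ^+ m.
    move=> hs.
    have [vs0 vs2] : v + s *: u != 0 /\ enorm (v + s *: u) <= 2.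
      apply: hvu; apply: (@near_root_le k); apply: le_trans hs _.
      by case/andP: rk.
    have -> : (Z`_m).[s] = (map_poly (horner_eval s) Z)`_m by rewrite coef_map.
    rewrite ler_pdivlMr ?exprn_gt0 //; apply: coef_circle => // t' t1.
    rewrite -hZ; apply: slice_max => //.
    - by lra.
    - by move=> z /(hG _ hs) /hM.
    apply: le_trans (enormD _ _) _; rewrite enormZ t1.
    have := enorm_ge0 (v + s *: u); nra.
  have Zc m i : cnorm (Z`_m)`_i <= 2 ^+ k * (M / tau ^+ m) * 2 ^+ m.
    apply: le_trans (coef_near_roots rk (sZ m) (Zw m) i) _.
    have -> : 4 / root_radius k = 2 ^+ (2 ^ k).
      by rewrite /root_radius; field; rewrite expf_neq0.
    apply: ler_wpM2l; first by rewrite mulr_ge0 ?divr_ge0 ?exprn_ge0 // ltW.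
    by rewrite -exprM ler_weXn2l ?ler1n // mulnC leq_divM.
  have Zt m : cnorm (map_poly (horner_eval w) Z)`_m <= 2 ^+ k * M * (4 / tau) ^+ m.
    rewrite coef_map /= /horner_eval.
    apply: le_trans (horner_norm_le (sZ m) (Zc m) hw) _.
    have -> : \sum_(i < m.+1) (1 : R) ^+ i = m.+1%:R.
      by under eq_bigr do rewrite expr1n; rewrite sumr_const card_ord.
    have m2 : m.+1%:R <= (2 : R) ^+ m by rewrite -natrX ler_nat ltn_expl.
    have -> : 2 ^+ k * M * (4 / tau) ^+ m = 2 ^+ k * (M / tau ^+ m) * 2 ^+ m * 2 ^+ m.
      by rewrite expr_div_n -[in 4 ^+ m](_ : 2 * 2 = 4) ?exprMn; [ring|ring].
    apply: ler_wpM2l m2.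
    by rewrite !mulr_ge0 ?divr_ge0 ?exprn_ge0 ?invr_ge0 ?exprn_ge0 // ltW.
  rewrite hZ.
  have tq : cnorm t <= tau / 8 by rewrite ht.
  rewrite horner_coef; apply: le_trans (cnorm_sum _ _ _) _.
  apply: (@le_trans _ _ (\sum_(m < size (map_poly (horner_eval w) Z))
     2 ^+ k * M * (1/2) ^+ m)).
    apply: ler_sum => m _; rewrite cnormM cnormX ht.
    apply: le_trans (ler_wpM2r _ (Zt m)) _; first by rewrite exprn_ge0 // ltW.
    have -> : (1 / 2 : R) = 4 / tau * (tau / 8) by field; rewrite gt_eqF.
    by rewrite [(4 / tau * _) ^+ _]exprMn mulrA.
  rewrite -mulr_sumr mulrC -[2 * _ * M]mulrA ler_wpM2r ?mulr_ge0 ?exprn_ge0 //.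
  have := subrX1 (1/2 : R) (size (map_poly (horner_eval w) Z)).
  have : (0 : R) <= (1 / 2) ^+ size (map_poly (horner_eval w) Z).
    by rewrite exprn_ge0.
  by lra.
(* The maximum principle in [x] gives the smaller values of [x]. *)
move=> x y hx hy f pf M hM.
have [q hq] := polyfun_line (b + y *: u) v pf.
have qE s : f (b + s *: v + y *: u) = q.[s] by rewrite -hq addrAC.
rewrite qE; apply: (@maximum_principle _ q 0 (tau / 8)) => //; last by rewrite subr0.
move=> t; rewrite subr0 => ht; rewrite -qE.
have tn0 : t != 0 by rewrite -cnorm_gt0 ht.
have -> : b + t *: v + y *: u = b + t *: (v + (y / t) *: u).
  by rewrite scalerDr scalerA [t * _]mulrC divfK // addrA.
apply: core => //; rewrite cnormM cnormV ht ler_pdivrMr ?mul1r //.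
Qed.

End PolynomialFunctions.

(** * Nets of circles and of slices *)

Section Nets.
Context {R : realType}.
Notation C := (Cplx R).
Notation V := 'rV[Cplx R]_2.
Implicit Types (z w b v u : V).

Lemma interval_net (r : R) : 0 < r ->
  exists s : seq R, forall x, `|x| <= 1 -> exists2 y, y \in s & `|x - y| <= r.
Proof.
move=> r0; pose N := (Num.truncn (2 / r)).+1.
exists [seq - 1 + i%:R * r | i <- iota 0 N] => x; rewrite ler_norml => /andP[x1 x2].
have q0 : 0 <= (x + 1) / r by rewrite divr_ge0 ?(ltW r0) //; lra.
pose i := Num.truncn ((x + 1) / r).
have /andP[i1 i2] := truncn_itv q0; rewrite -/i in i1 i2.
exists (- 1 + i%:R * r).
  apply/mapP; exists i => //; rewrite mem_iota add0n leq0n /= /N ltnS.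
  apply: le_truncn; rewrite ler_pM2r ?invr_gt0 //; lra.
rewrite ler_pdivlMr // in i1; rewrite ltr_pdivrMr // -natr1 mulrDl mul1r in i2.
rewrite ler_norml; apply/andP; split; lra.
Qed.

Lemma cnorm_le_sum (x : C) : cnorm x <= `|complex.Re x| + `|complex.Im x|.
Proof.
rewrite -(@ler_pXn2r _ 2) // ?nnegrE ?cnorm_ge0 ?addr_ge0 // cnorm_sqr sqrrD.
by rewrite !real_normK ?num_real // -addrA lerD2l lerDr mulrn_wge0 // mulr_ge0.
Qed.

Lemma Re_le (x : C) : `|complex.Re x| <= cnorm x.
Proof.
rewrite -(@ler_pXn2r _ 2) // ?nnegrE ?cnorm_ge0 // cnorm_sqr.
by rewrite real_normK ?num_real // lerDl sqr_ge0.
Qed.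

Lemma Im_le (x : C) : `|complex.Im x| <= cnorm x.
Proof.
rewrite -(@ler_pXn2r _ 2) // ?nnegrE ?cnorm_ge0 // cnorm_sqr.
by rewrite real_normK ?num_real // lerDr sqr_ge0.
Qed.

Lemma disc_net (r : R) : 0 < r ->
  exists s : seq C, forall x, cnorm x <= 1 -> exists2 y, y \in s & cnorm (x - y) <= r.
Proof.
move=> r0; have [|s hs] := @interval_net (r / 2); first by lra.
exists [seq (p +i* q)%C : C | p <- s, q <- s] => x x1.
have [a sa ha] := hs _ (le_trans (Re_le x) x1).
have [b sb hb] := hs _ (le_trans (Im_le x) x1).
exists (a +i* b)%C; first by apply/allpairsP; exists (a, b).
apply: le_trans (cnorm_le_sum _) _; case: x {x1} ha hb => /= *; lra.
Qed.

Lemma ball_net (r : R) : 0 < r ->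
  exists s : seq V, forall z, enorm z <= 1 -> exists2 p, p \in s & enorm (z - p) <= r.
Proof.
move=> r0; have [|s hs] := @disc_net (r / 2); first by lra.
exists [seq \row_(j < 2) (if j == 0 then p else q) | p <- s, q <- s] => z z1.
have [a sa ha] := hs _ (le_trans (coord_le z 0) z1).
have [b sb hb] := hs _ (le_trans (coord_le z 1) z1).
exists (\row_(j < 2) (if j == 0 then a else b)); first by apply/allpairsP; exists (a, b).
by apply: le_trans (enorm_le_sum _) _; rewrite !mxE /=; lra.
Qed.

Lemma subset_net (L : set V) (r : R) : 0 < r -> (forall z, L z -> enorm z <= 1) ->
  exists2 s : seq V, forall p, p \in s -> L p &
    forall z, L z -> exists2 p, p \in s & enorm (z - p) <= r.
Proof.
move=> r0 L1; have [|s hs] := @ball_net (r / 2); first by lra.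
suff [s' s'L s's] : exists2 s' : seq V, forall p, p \in s' -> L p &
    forall z, L z -> (exists2 p, p \in s & enorm (z - p) <= r / 2) ->
      exists2 p, p \in s' & enorm (z - p) <= r.
  by exists s' => // z Lz; apply: s's => //; apply: hs; exact: L1.
elim: s {hs} => [|p s [s' s'L s's]]; first by exists [::] => // z _ [].
have [[q Lq qp]|np] := pselect (exists2 q, L q & enorm (q - p) <= r / 2).
  exists (q :: s') => [p'|z Lz [p']]; first by rewrite inE => /predU1P[->|/s'L].
  rewrite inE => /predU1P[->|p's] zp.
    exists q; first exact: mem_head.
    by have := enorm_triangle z p q; rewrite (enormB p); lra.
  have [|p'' p''s h] := s's z Lz; first by exists p'.
  by exists p'' => //; rewrite inE p''s orbT.
exists s' => // z Lz [p']; rewrite inE => /predU1P[->|p's] zp.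
  by case: np; exists z.
by apply: s's => //; exists p'.
Qed.

Lemma csqrt_unit (x : C) : cnorm x = 1 -> exists2 w : C, cnorm w = 1 & w ^+ 2 = x.
Proof.
move=> x1; have [w wx] := csqrt x; exists w => //.
by apply/eqP; rewrite -(@eqrXn2 _ 2) ?cnorm_ge0 // -cnormX wx x1 expr1n.
Qed.

Lemma square_roots_of_seq (s : seq C) : (forall x, x \in s -> cnorm x = 1) ->
  exists2 s' : seq C, size s' = (size s).*2 /\ (forall x, x \in s' -> cnorm x = 1) &
    forall x, x \in s -> exists2 y, y ^+ 2 = x & (y \in s') && (- y \in s').
Proof.
elim: s => [|x s IH] hs; first by exists [::].
have [|s' [ss s1] h] := IH; first by move=> y ys; apply: hs; rewrite inE ys orbT.
have [y y1 yx] := csqrt_unit (hs x (mem_head _ _)).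
exists [:: y, - y & s'] => [|t].
  split=> [|t]; first by rewrite /= ss.
  by rewrite !inE => /or3P[/eqP->|/eqP->|/s1] //; rewrite cnormN.
rewrite inE => /predU1P[->|/h[t' <- /andP[ts nts]]].
  by exists y; rewrite // !inE !eqxx ?orbT.
by exists t'; rewrite // !inE ts nts !orbT.
Qed.

(** The roots of unity of order [2 ^ j], with a bound on squared distances. If [y]
    is near [x ^+ 2] and [r] is a square root of [y], then the squared distances
    [a] and [b] of [x] to [r] and [- r] satisfy [a + b = 4] while [a * b] is
    small; once [a * b <= 2], the smaller one is at most a third of the product.
    Since [2 < 3], the sum of the squared radii tends to 0. *)
Lemma circle_net j : exists2 s : seq C, size s = (2 ^ j)%N &
  (forall x, x \in s -> cnorm x = 1) /\
  forall x : C, cnorm x = 1 -> exists2 y, y \in s & cnorm (x - y) ^+ 2 <= 6 / 3 ^+ j.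
Proof.
elim: j => [|j [s ss [s1 h]]].
  exists [:: 1] => //; split => [x|x x1]; first by rewrite inE => /eqP->; exact: cnorm1.
  exists 1; rewrite ?mem_head // expr0 divr1.
  have := cnormD x (- 1); rewrite x1 cnormN cnorm1; have := cnorm_ge0 (x - 1); nra.
have [s' [ss' s1'] h'] := square_roots_of_seq s1.
exists s'; first by rewrite ss' ss expnS mul2n.
split=> // x x1; have [|y ys xy] := h (x ^+ 2); first by rewrite cnormX x1 expr1n.
have [r ry /andP[rs nrs]] := h' _ ys.
have r1 : cnorm r = 1 by exact: s1'.
have par : cnorm (x - r) ^+ 2 + cnorm (x + r) ^+ 2 = 4.
  have := cnorm_sqr x; have := cnorm_sqr r; rewrite x1 r1 !cnorm_sqr.
  by case: x r {x1 xy ry rs nrs r1} => [a b] [c d] /=; lra.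
have prod : cnorm (x - r) ^+ 2 * cnorm (x + r) ^+ 2 <= 6 / 3 ^+ j.
  by rewrite -exprMn -cnormM -subr_sqr ry.
have main (a b : R) : 0 <= a -> 0 <= b -> a + b = 4 -> a * b <= 6 / 3 ^+ j -> a <= b ->
    a <= 6 / 3 ^+ j.+1.
  move=> a0 b0 ab4 ab alb.
  move: ab; clear -a0 b0 ab4 alb; case: j => [|j] ab.
    by rewrite expr1; lra.
  have q2 : 6 / 3 ^+ j.+1 <= 2 :> R.
    rewrite ler_pdivrMr ?exprn_gt0 //.
    have : (1 : R) <= 3 ^+ j by apply: exprn_ege1; lra.
    by rewrite exprS; lra.
  have a1 : a <= 1 by nra.
  have -> : 6 / 3 ^+ j.+2 = (6 / 3 ^+ j.+1) / 3 :> R.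
    by rewrite (exprS 3 j.+1); field; rewrite expf_neq0.
  rewrite ler_pdivlMr //; nra.
have [le|/ltW le] := leP (cnorm (x - r) ^+ 2) (cnorm (x + r) ^+ 2).
  by exists r => //; apply: main le => //; rewrite sqr_ge0.
exists (- r) => //; rewrite opprK; apply: main le => //; rewrite ?sqr_ge0 //.
  by rewrite addrC.
by rewrite mulrC.
Qed.

(** As in [circle_net]; here it is enough that the larger of the two distances is
    at least 1. *)
Lemma near_root_cover k : exists2 s : seq C, size s = (2 ^ k)%N &
  (forall x, x \in s -> cnorm x = 1) /\ forall (rho : R) (w : C),
    cnorm (w ^+ (2 ^ k) - 1) <= rho -> exists2 y, y \in s & cnorm (w - y) <= rho.
Proof.
elim: k => [|k [s ss [s1 h]]].
  exists [:: 1] => //; split => [x|rho w hw]; first by rewrite inE => /eqP->; exact: cnorm1.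
  by exists 1; rewrite ?mem_head.
have [s' [ss' s1'] h'] := square_roots_of_seq s1.
exists s'; first by rewrite ss' ss expnS mul2n.
split=> // rho w; rewrite expnS exprM => /h[y ys wy].
have [r ry /andP[rs nrs]] := h' _ ys.
have r1 : cnorm r = 1 by exact: s1'.
have prod : cnorm (w - r) * cnorm (w + r) <= rho by rewrite -cnormM -subr_sqr ry.
have two : 2 <= cnorm (w - r) + cnorm (w + r).
  have := cnormD (w + r) (- (w - r)); have -> : w + r - (w - r) = 2 * r by ring.
  rewrite cnormM r1 mulr1 cnormN addrC.
  by have -> : cnorm (2 : C) = 2 by rewrite -(normr_nat R 2) -cnorm_creal /creal rmorph_nat.
have [le|/ltW le] := leP (cnorm (w - r)) (cnorm (w + r)).
  by exists r => //; have := cnorm_ge0 (w - r); nra.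
by exists (- r) => //; rewrite opprK; have := cnorm_ge0 (w + r); nra.
Qed.

Lemma slice_net b v j : v != 0 -> enorm b < 1 ->
  exists2 s : seq V, size s = (2 ^ j)%N &
    forall z, slice b v z -> exists2 p, p \in s & enorm (z - p) ^+ 2 <= 6 / 3 ^+ j.
Proof.
move=> v0 b1; have [c [r [r0 /andP[_ r1] E]]] := slice_circle v0 b1.
have n0 : 0 < enorm v by rewrite lt_def enorm_eq0 v0 enorm_ge0.
have [s ss [_ hs]] := circle_net j.
exists [seq b + (c + creal r * x) *: v | x <- s]; first by rewrite size_map.
move=> z [z1 [t zt]].
have tr : cnorm (t - c) = r.
  have := E t; rewrite -zt z1 expr1n subrr => /esym/eqP.
  rewrite mulf_eq0 sqrf_eq0 gt_eqF //= subr_eq0 eqrXn2 ?cnorm_ge0 // ?ltW //.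
  by move/eqP.
have rn0 : creal r != 0 by rewrite creal_eq0 gt_eqF.
have [|x xs hx] := hs ((t - c) / creal r).
  by rewrite cnormM cnormV cnorm_creal tr gtr0_norm // divff // gt_eqF.
exists (b + (c + creal r * x) *: v); first exact: map_f.
have -> : z - (b + (c + creal r * x) *: v) =
   (creal r * ((t - c) / creal r - x)) *: v.
  rewrite zt opprD addrACA subrr add0r -scalerBl; congr (_ *: v); field; exact: rn0.
rewrite enormZ cnormM cnorm_creal gtr0_norm // !exprMn; apply: le_trans hx.
rewrite mulrAC ler_piMl ?sqr_ge0 //; rewrite mulrC //.
Qed.

(** Moving a point radially onto a circle. *)
Lemma circle_project (c t : C) (r g A : R) : 0 < g -> 0 < r -> g / 2 <= r ->
  `|cnorm (t - c) ^+ 2 - r ^+ 2| <= A ->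
  exists2 t' : C, cnorm (t' - c) = r & cnorm (t - t') <= 2 * A / g.
Proof.
move=> g0 r0 rg nn.
have d3 : `|cnorm (t - c) - r| <= 2 * A / g.
  rewrite ler_pdivlMr //; rewrite subr_sqr normrM in nn.
  have p0 : 0 <= `|cnorm (t - c) - r| by [].
  have : r <= `|cnorm (t - c) + r|.
    by rewrite ger0_norm ?addr_ge0 ?cnorm_ge0 ?(ltW r0) // lerDr cnorm_ge0.
  move: nn p0 rg; clear; nra.
suff [t' tc tt] : exists2 t' : C, cnorm (t' - c) = r & cnorm (t - t') = `|cnorm (t - c) - r|.
  by exists t' => //; rewrite tt.
have [tc|tc] := eqVneq t c.
  exists (c + creal r); first by rewrite addrAC subrr add0r cnorm_creal gtr0_norm.
  by rewrite tc subrr cnorm0 sub0r opprD addrA subrr sub0r cnormN cnorm_creal normrN.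
have n0 : 0 < cnorm (t - c) by rewrite cnorm_gt0 subr_eq0.
have nn0 : creal (cnorm (t - c)) != 0 by rewrite creal_eq0 gt_eqF.
exists (c + creal r / creal (cnorm (t - c)) * (t - c)).
  rewrite addrAC subrr add0r !cnormM cnormV !cnorm_creal !gtr0_norm //.
  by rewrite mulfVK // gt_eqF.
have -> : t - (c + creal r / creal (cnorm (t - c)) * (t - c)) =
   (creal (cnorm (t - c) - r) / creal (cnorm (t - c))) * (t - c).
  by rewrite crealB; field.
rewrite !cnormM cnormV !cnorm_creal [`|cnorm (t - c)|]gtr0_norm //.
by rewrite mulfVK // gt_eqF.
Qed.

Lemma slice_radius_ge (h : R) b v (r : R) : 0 <= h < 1 -> enorm b <= h ->
  enorm v <= 2 -> 0 < r -> 1 - enorm b ^+ 2 <= enorm v ^+ 2 * r ^+ 2 ->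
  (1 - h ^+ 2) / 2 <= r.
Proof.
move=> /andP[h0 h1] bh v2 r0 rg.
have g0 : 0 < 1 - h ^+ 2 by rewrite subr_gt0 expr_lt1.
rewrite -(@ler_pXn2r _ 2) // ?nnegrE ?(ltW r0) //; last by lra.
have b2 : enorm b ^+ 2 <= h ^+ 2 by rewrite lerXn2r // nnegrE ?enorm_ge0.
have v4 : enorm v ^+ 2 <= 4 by have := enorm_ge0 v; move: v2; clear; nra.
have r20 : 0 <= r ^+ 2 by exact: sqr_ge0.
have h20 : 0 <= h ^+ 2 by exact: sqr_ge0.
rewrite expr_div_n; move: (r ^+ 2) (h ^+ 2) (enorm v ^+ 2) (enorm b ^+ 2) r20 h20 v4 b2 rg g0.
clear; move=> x y p q ? ? ? ? ? ?.
have : 1 - y <= 4 * x by nra.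
have : (1 - y) ^+ 2 <= 1 - y by nra.
lra.
Qed.

(** Slices by nearby lines are close to each other: move a point of one slice
    to the other line and project it onto the circle, whose radius is bounded
    below because [b] stays away from the sphere. *)
Lemma slice_close (h : R) : h < 1 -> exists2 K : R, 0 < K & forall b v v',
  enorm b <= h -> 1 <= enorm v -> enorm v <= 2 -> 1 <= enorm v' -> enorm v' <= 2 ->
  forall z, slice b v' z -> exists2 z', slice b v z' & enorm (z - z') <= K * enorm (v - v').
Proof.
move=> h1.
have [h0|h0] := ltP h 0.
  by exists 1 => // b v v' bh; have := enorm_ge0 b; lra.
pose g := 1 - h ^+ 2.
have g0 : 0 < g by rewrite subr_gt0 expr_lt1.
pose K := 2 + 2 * (2 * 20 / g).
have K0 : 0 < K by rewrite addr_gt0 // !mulr_gt0 // invr_gt0.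
exists K => // b v v' bh v1 v2 v1' v2' z [z1 [t zt]].
have v0 : v != 0 by rewrite -enorm_eq0; apply/eqP; move: v1; clear; lra.
have b1 : enorm b < 1 by exact: le_lt_trans h1.
have [c [r [r0 /andP[rg r1] E]]] := slice_circle v0 b1.
have e0 := enorm_ge0 (v - v'); set e := enorm (v - v') in e0 *.
have e4 : e <= 4.
  by have := enormD v (- v'); rewrite enormN -/e; move: v2 v2'; clear; lra.
have t2 : cnorm t <= 2.
  have h2 : cnorm t * enorm v' <= 2.
    rewrite -enormZ; have -> : t *: v' = z - b by rewrite zt addrAC subrr add0r.
    by have := enormD z (- b); rewrite enormN z1; move: b1; clear; lra.
  by have := cnorm_ge0 t; move: h2 v1'; clear; nra.
pose z1' := b + t *: v.
have d1 : enorm (z - z1') <= 2 * e.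
  have -> : z - z1' = - (t *: (v - v')).
    by rewrite zt /z1' scalerBr opprD addrACA subrr add0r opprB.
  by rewrite enormN enormZ -/e ler_wpM2r.
have l1 : enorm z1' <= 1 + 2 * e.
  by have := enormD z (z1' - z); rewrite addrC subrK z1 enormB; move: d1; clear; lra.
have l2 : 1 - 2 * e <= enorm z1'.
  by have := enormD z1' (z - z1'); rewrite addrC subrK z1; move: d1; clear; lra.
have d2 : `|enorm z1' ^+ 2 - 1| <= 20 * e.
  have := enorm_ge0 z1'; move: l1 l2 e4 e0; clear; move: (enorm z1') => x ? ? ? ? ?.
  by rewrite ler_norml; apply/andP; split; nra.
rewrite E in d2.
have nn : `|cnorm (t - c) ^+ 2 - r ^+ 2| <= 20 * e.
  apply: le_trans d2; rewrite normrM ger0_norm ?sqr_ge0 // ler_peMl //.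
  by rewrite expr_ge1 ?enorm_ge0.
have [|t' tc tt] := circle_project g0 r0 _ nn.
  by apply: slice_radius_ge rg => //; rewrite h0.
exists (b + t' *: v).
  split; last by exists t'.
  apply/eqP; rewrite -(@eqrXn2 _ 2) ?enorm_ge0 // expr1n -subr_eq0 E tc subrr mulr0 //.
have d4 : enorm (z1' - (b + t' *: v)) <= 2 * (2 * (20 * e) / g).
  have -> : z1' - (b + t' *: v) = (t - t') *: v.
    by rewrite /z1' opprD addrACA subrr add0r scalerBl.
  by rewrite enormZ mulrC ler_pM ?enorm_ge0 ?cnorm_ge0.
apply: le_trans (enorm_triangle z z1' (b + t' *: v)) _.
apply: le_trans (lerD d1 d4) _.
by rewrite le_eqVlt /K; apply/orP; left; apply/eqP; ring.
Qed.

End Nets.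

(** * An area argument *)

Section AreaLemma.
Context {R : realType}.
Notation C := (Cplx R).

Let mu := ((@lebesgue_measure R) \x (@lebesgue_measure R))%E.
Let box (x y r : R) : set (R * R) := `[x - r, x + r] `*` `[y - r, y + r].

Let box_measurable x y r : measurable (box x y r).
Proof. by apply: measurableX; exact: measurable_itv. Qed.

Let segment_length (x r : R) : 0 < r ->
  lebesgue_measure `[x - r, x + r]%classic = (2 * r)%:E.
Proof.
move=> r0; apply: eq_trans (lebesgue_measure_itv _) _.
by rewrite /= lte_fin ifT; [rewrite -EFinB; congr EFin; ring | lra].
Qed.

Let box_area x y (r : R) : 0 < r -> mu (box x y r) = (4 * r ^+ 2)%:E.
Proof.
move=> r0; have E := product_measure1E (@lebesgue_measure R) (@lebesgue_measure R)
  (measurable_itv `[x - r, x + r]) (measurable_itv `[y - r, y + r]).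
apply: (eq_trans E).
apply: eq_trans (congr2 mule (segment_length x r0) (segment_length y r0)) _.
by rewrite -EFinM; congr EFin; ring.
Qed.

(** If the discs covered the square with half side [sigma], its area would be at
    most the total area of the squares circumscribed about the discs. *)
Lemma square_not_covered (s : seq (C * R)) (sigma : R) : 0 < sigma ->
  (forall p, p \in s -> 0 < p.2) ->
  \sum_(p <- s) 4 * p.2 ^+ 2 < 4 * sigma ^+ 2 ->
  exists2 w : C, cnorm w <= 2 * sigma & forall p, p \in s -> p.2 < cnorm (w - p.1).
Proof.
move=> s0 sp area; apply: contrapT => hno.
pose U := \big[setU/set0]_(p <- s) box (complex.Re p.1) (complex.Im p.1) p.2.
have mU (t : seq (C * R)) : (forall p, p \in t -> 0 < p.2) ->
    measurable (\big[setU/set0]_(p <- t) box (complex.Re p.1) (complex.Im p.1) p.2) /\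
    (mu (\big[setU/set0]_(p <- t) box (complex.Re p.1) (complex.Im p.1) p.2)
      <= (\sum_(p <- t) 4 * p.2 ^+ 2)%:E)%E.
  elim: t => [|p t IH] ht.
    rewrite !big_nil; split; first exact: measurable0.
    by rewrite (_ : mu set0 = 0%E) ?lexx //; exact: measure0.
  have [|mt lt] := IH; first by move=> q qt; apply: ht; rewrite inE qt orbT.
  have p0 : 0 < p.2 by apply: ht; exact: mem_head.
  rewrite !big_cons; split; first exact: measurableU.
  apply: le_trans (measureU2 _ _ _) _ => //; first exact: box_measurable.
  by rewrite EFinD -(box_area (complex.Re p.1) (complex.Im p.1) p0) leeD2l.
have [mU1 mU2] := mU s sp.
have sub : box 0 0 sigma `<=` U.
  move=> [a b] [/= + +]; rewrite !in_itv /= !sub0r !add0r => /andP[a1 a2] /andP[b1 b2].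
  have [[p ps hp]|np] := pselect (exists2 p, p \in s & cnorm ((a +i* b)%C - p.1) <= p.2).
    rewrite /U (big_rem p) //=; left.
    have := le_trans (Re_le _) hp; have := le_trans (Im_le _) hp.
    case: (p.1) => [c d] /=; rewrite !ler_norml => /andP[h1 h2] /andP[h3 h4].
    by split; rewrite /= in_itv /=; apply/andP; split; lra.
  exfalso; apply: hno; exists (a +i* b)%C.
    apply: le_trans (cnorm_le_sum _) _ => /=.
    have : `|a| <= sigma by rewrite ler_norml a1.
    have : `|b| <= sigma by rewrite ler_norml b1.
    by lra.
  by move=> p ps; rewrite ltNge; apply/negP => h; apply: np; exists p.
have : (mu (box 0 0 sigma) <= mu U)%E.
  apply: le_measure => //; last exact: mem_set.
  by apply: mem_set; exact: box_measurable.
rewrite box_area // => /le_trans /(_ mU2); rewrite lee_fin leNgt area //.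
Qed.

End AreaLemma.

(** * Thin families of slices *)

(** The exponent 2 is the real dimension of the set of complex lines through a
    point: the set of lines that meet a thin set has small area. *)
Definition thin (R : realType) (G : set 'rV[Cplx R]_2) (e : R) : Prop :=
  exists B : seq ('rV[Cplx R]_2 * R), [/\ forall p, p \in B -> 0 < p.2,
    forall z, G z -> exists2 p, p \in B & enorm (z - p.1) <= p.2 &
    \sum_(p <- B) p.2 ^+ 2 <= e].

(** The union of the slices through [b] whose slopes are close to roots of unity
    of order [2 ^ k]. *)
Definition tube (R : realType) (b v u : 'rV[Cplx R]_2) (k : nat) :
    set 'rV[Cplx R]_2 :=
  [set z | exists2 w : Cplx R, cnorm (w ^+ (2 ^ k) - 1) <= @root_radius R k &
                               slice b (v + w *: u) z].

Section ThinFamilies.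
Context {R : realType}.
Notation C := (Cplx R).
Notation V := 'rV[Cplx R]_2.
Implicit Types (z b v u : V) (G : set V) (e : R).

Lemma thin_sub G G' e e' : G' `<=` G -> e <= e' -> thin G e -> thin G' e'.
Proof.
move=> s ee [B [B0 cov sm]]; exists B; split => // [z /s /cov //|].
exact: le_trans ee.
Qed.

Lemma thin_setU G G' e e' : thin G e -> thin G' e' -> thin (G `|` G') (e + e').
Proof.
move=> [B [B0 cov sm]] [B' [B0' cov' sm']]; exists (B ++ B'); split.
- by move=> p; rewrite mem_cat => /orP[/B0|/B0'].
- by move=> z [/cov|/cov'] [p pB h]; exists p => //; rewrite mem_cat pB ?orbT.
- by rewrite big_cat lerD.
Qed.

Lemma thin0 : thin (set0 : set V) 0.
Proof. by exists [::]; split => //; rewrite big_nil. Qed.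

Lemma thin_seq (I : eqType) (s : seq I) (F : I -> set V) e :
  (forall i, i \in s -> thin (F i) e) ->
  thin [set z | exists2 i, i \in s & F i z] ((size s)%:R * e).
Proof.
elim: s => [|i s IH] h.
  by apply: thin_sub thin0; [move=> z [] | rewrite mul0r].
apply: (thin_sub _ _ (thin_setU (h i (mem_head _ _)) (IH _))).
- move=> z [j]; rewrite inE => /predU1P[->|js] Fz; [by left | by right; exists j].
- by rewrite /= -natr1 mulrDl mul1r addrC.
- by move=> j js; apply: h; rewrite inE js orbT.
Qed.

Lemma thin_ball p (r : R) : 0 < r -> thin [set z | enorm (z - p) <= r] (r ^+ 2).
Proof.
move=> r0; exists [:: (p, r)]; split => [q|z h|].
- by rewrite inE => /eqP->.
- by exists (p, r); rewrite ?mem_head.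
- by rewrite big_seq1.
Qed.

Lemma frame_norm v (sigma : R) (w : C) : enorm v = 1 -> 0 < sigma <= 1/2 ->
  cnorm w <= 2 -> 1 <= enorm (v + w *: (creal sigma *: perp v)) <= 2.
Proof.
move=> v1 /andP[s0 s1] w2.
have := enorm_frame 1 (w * creal sigma) v1; rewrite scale1r -scalerA cnorm1 expr1n.
rewrite cnormM cnorm_creal gtr0_norm //.
set x := enorm _ => hx; have x0 : 0 <= x by exact: enorm_ge0.
have := cnorm_ge0 w; move: (cnorm w) w2 hx => y y2 hx y0.
have : 0 <= y * sigma <= 1 by apply/andP; split; nra.
by move=> /andP[? ?]; apply/andP; split; nra.
Qed.

Lemma frame_neq0 v (sigma : R) (w : C) : enorm v = 1 -> 0 < sigma <= 1/2 ->
  cnorm w <= 2 -> v + w *: (creal sigma *: perp v) != 0.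
Proof.
move=> v1 s1 w2; have /andP[h _] := frame_norm v1 s1 w2.
by rewrite -enorm_eq0; apply/eqP; lra.
Qed.

Lemma root_radius_le9 k : (4 <= k)%N -> @root_radius R k <= 4 / 9 ^+ k.
Proof.
move=> k4; rewrite /root_radius ler_pM2l // lef_pV2 ?posrE ?exprn_gt0 //.
apply: (@le_trans _ _ (2 ^+ (4 * k))).
  have -> : (2 : R) ^+ (4 * k) = 16 ^+ k by rewrite exprM; congr (_ ^+ k); ring.
  by rewrite lerXn2r ?nnegrE //; lra.
rewrite ler_weXn2l ?ler1n //.
elim: k k4 => // k IH; rewrite leq_eqVlt => /predU1P[<-//|k4].
by have := IH k4; rewrite expnS; lia.
Qed.

Lemma small_power (x e : R) : 0 < e -> exists k0 : nat, forall k, (k0 <= k)%N ->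
  x * (1/2) ^+ k <= e.
Proof.
move=> e0; exists (Num.truncn (x / e)).+1 => k hk.
rewrite expr_div_n expr1n mul1r ler_pdivrMr ?exprn_gt0 // mulrC -ler_pdivrMr //.
apply: le_trans (ltW (truncnS_gt _)) _.
by rewrite -natrX ler_nat (leq_trans hk) // ltnW // ltn_expl.
Qed.

(** There are [2 ^ k] circles, each covered by [2 ^ (4 * k)] balls of radius
    comparable to [9 ^- k]; and [32 < 81]. *)
Lemma tube_thin (h e : R) : h < 1 -> 0 < e -> exists2 k, (3 <= k)%N &
  forall b v (sigma : R), enorm b <= h -> enorm v = 1 -> 0 < sigma <= 1/2 ->
    thin (tube b v (creal sigma *: perp v) k) e.
Proof.
move=> h1 e0; have [K K0 close] := slice_close h1.
have [k0 hk0] := small_power ((4 * K + 3) ^+ 2) e0.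
pose k := maxn 4 k0; have k4 : (4 <= k)%N by rewrite leq_maxl.
exists k => [|b v sigma bh v1 s1]; first exact: leq_trans k4.
pose r := (4 * K + 3) / 9 ^+ k.
have r0 : 0 < r by rewrite divr_gt0 ?exprn_gt0 //; lra.
pose u := creal sigma *: perp v.
have [s ss [s1' hs]] := @near_root_cover R k.
have net zeta : zeta \in s -> thin
    [set z | exists2 z', slice b (v + zeta *: u) z' & enorm (z - z') <= K * @root_radius R k]
    ((2 ^ (4 * k))%:R * r ^+ 2).
  move=> zs; have z2 : cnorm zeta <= 2 by rewrite s1'//; lra.
  have [|N sN hN] := @slice_net R b _ (4 * k) (frame_neq0 v1 s1 z2); first by lra.
  rewrite -sN; pose F p := [set z | enorm (z - p) <= r].
  apply: (thin_sub _ (lexx _) (thin_seq (F := F) _)).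
    move=> z [z' /hN[p pN z'p] zz']; exists p => //=.
    have z'p' : enorm (z' - p) <= 3 / 9 ^+ k.
      have p0 : 0 <= 3 / 9 ^+ k :> R by rewrite divr_ge0 ?exprn_ge0.
      rewrite -(@ler_pXn2r _ 2) // ?nnegrE ?enorm_ge0 //.
      apply: le_trans z'p _; rewrite expr_div_n -exprM [(k * 2)%N]mulnC !exprM.
      have -> : (3 : R) ^+ 4 = 81 by ring.
      have -> : (9 : R) ^+ 2 = 81 by ring.
      by rewrite ler_pM2r ?invr_gt0 ?exprn_gt0 //; lra.
    apply: le_trans (enorm_triangle z z' p) _.
    have hr : K * root_radius k <= K * (4 / 9 ^+ k).
      by rewrite ler_pM2l // root_radius_le9.
    have -> : r = K * (4 / 9 ^+ k) + 3 / 9 ^+ k by rewrite /r; ring.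
    by move: zz' z'p' hr; clear; lra.
  by move=> p pN; exact: thin_ball.
apply: (thin_sub _ _ (thin_seq net)).
  move=> z [w wk wz]; have [zeta zs hz] := hs _ _ wk; exists zeta => //=.
  have z2 : cnorm zeta <= 2 by rewrite s1'//; lra.
  have w2 : cnorm w <= 2.
    apply: near_root_le; apply: le_trans wk _; apply: root_radius_le.
    exact: leq_trans k4.
  have /andP[a1 a2] := frame_norm v1 s1 z2.
  have /andP[a3 a4] := frame_norm v1 s1 w2.
  have [z' sz' zz'] := close _ _ _ bh a1 a2 a3 a4 _ wz.
  exists z' => //; apply: le_trans zz' _; rewrite ler_pM2l //.
  have -> : v + zeta *: u - (v + w *: u) = (zeta - w) *: u.
    by rewrite opprD addrACA subrr add0r scalerBl.
  rewrite enormZ; apply: le_trans hz; rewrite cnormB ler_piMr ?cnorm_ge0 //.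
  case/andP: s1 => sg0 sg1.
  by rewrite /u enormZ enorm_perp v1 cnorm_creal gtr0_norm // mulr1; move: sg1; clear; lra.
apply: le_trans (hk0 k (leq_maxr _ _)).
rewrite ss /r expr_div_n -exprM [(k * 2)%N]mulnC [9 ^+ _]exprM.
have -> : (9 : R) ^+ 2 = 81 by ring.
have -> : ((2 ^ k)%:R : R) = 2 ^+ k by rewrite natrX.
have -> : ((2 ^ (4 * k))%:R : R) = 16 ^+ k.
  by rewrite natrX exprM; congr (_ ^+ k); ring.
have -> : 2 ^+ k * (16 ^+ k * ((4 * K + 3) ^+ 2 / 81 ^+ k)) =
    (4 * K + 3) ^+ 2 * (32 / 81) ^+ k :> R.
  rewrite expr_div_n -[32 in RHS](_ : 2 * 16 = 32) ?exprMn; last by ring.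
  by field; rewrite expf_neq0.
rewrite ler_wpM2l ?sqr_ge0 // lerXn2r ?nnegrE //; lra.
Qed.

(** Some slice through [b] stays in [U] with margin [delta]; the margin makes the
    statement stable under small changes of the line. *)
Definition sees (U : set V) (delta : R) b : Prop := exists2 v, enorm v = 1 &
  forall z, slice b v z -> forall z', enorm (z' - z) < delta -> U z'.

Lemma tube_neq0 b v u k : v + u != 0 -> enorm b < 1 -> tube b v u k !=set0.
Proof.
move=> vu b1; have [c [r [r0 _ E]]] := slice_circle vu b1.
exists (b + (c + creal r) *: (v + u)); exists 1.
  by rewrite expr1n subrr cnorm0 ltW // root_radius_gt0.
rewrite scale1r; split; last by exists (c + creal r).
apply/eqP; rewrite -(@eqrXn2 _ 2) ?enorm_ge0 // expr1n -subr_eq0 E.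
by rewrite addrAC subrr add0r cnorm_creal gtr0_norm // subrr mulr0.
Qed.

(** Around each [b] that sees [U], the slices with slopes close to that of the
    given one stay in [U], and the tubes among them have a neighbourhood of [b]
    in their hull whose size is the same for all [b] and [k]. So finitely many
    tubes suffice, and their number is fixed before [k] is chosen. *)
Lemma thin_family (h delta e : R) (L U : set V) : h < 1 -> 0 < delta -> 0 < e ->
  (forall b, L b -> enorm b <= h) -> (forall b, L b -> sees U delta b) ->
  exists2 G : set V, G `<=` unit_sphere R & exists2 d : R, 0 < d &
    [/\ forall z, G z -> forall z', enorm (z' - z) < d -> U z',
        forall b, L b -> hull_at G b & thin G e].
Proof.
move=> h1 d0 e0 Lh Ls; have [K K0 close] := slice_close h1.
pose sigma := Num.min (1/2) (delta / (8 * K)).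
have s0 : 0 < sigma by rewrite lt_min; apply/andP; split; [lra | rewrite divr_gt0 // mulr_gt0].
have s12 : sigma <= 1/2 by rewrite ge_min lexx.
have sK : K * sigma <= delta / 8.
  have : sigma <= delta / (8 * K) by rewrite ge_min lexx orbT.
  by rewrite ler_pdivlMr ?mulr_gt0 //; lra.
have s1 : 0 < sigma <= 1/2 by rewrite s0.
pose tau := (1 - h) / 4; have t0 : 0 < tau by rewrite /tau; lra.
have [||s sL hs] := @subset_net R L (sigma * (tau / 8)).
- by rewrite mulr_gt0 //; lra.
- by move=> z /Lh; lra.
have e0' : 0 < e / (size s).+1%:R by rewrite divr_gt0.
have [k k3 hk] := tube_thin h1 e0'.
have vP b : exists v, L b -> enorm v = 1 /\
    forall z, slice b v z -> forall z', enorm (z' - z) < delta -> U z'.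
  have [/Ls [v v1 hv]|nL] := pselect (L b); first by exists v.
  by exists 0.
have [v hv] := choice vP.
pose T b := tube b (v b) (creal sigma *: perp (v b)) k.
exists [set z | exists2 b, b \in s & T b z].
  by move=> z [b bs [w _ [z1 _]]].
exists (delta / 2); first by lra.
split.
- move=> z [b bs [w wk wz]] z' zz'; have [v1 vU] := hv b (sL b bs).
  have w2 : cnorm w <= 2 by apply: near_root_le; apply: le_trans wk _; exact: root_radius_le.
  have /andP[a3 a4] := frame_norm v1 s1 w2.
  have a1 : 1 <= enorm (v b) by rewrite v1.
  have a2 : enorm (v b) <= 2 by rewrite v1; lra.
  have [z'' sz'' h''] := close _ _ _ (Lh _ (sL b bs)) a1 a2 a3 a4 _ wz.
  apply: (vU z'' sz''); apply: le_lt_trans (enorm_triangle _ z _) _.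
  suff : enorm (z - z'') <= delta / 2 by lra.
  apply: le_trans h'' _.
  rewrite opprD addrA subrr sub0r enormN enormZ enormZ enorm_perp v1 mulr1.
  rewrite cnorm_creal gtr0_norm //; have := cnorm_ge0 w; nra.
- move=> b' Lb'; have [b bs hb] := hs _ Lb'; have [v1 vU] := hv b (sL b bs).
  have bh := Lh _ (sL b bs).
  apply: (@hull_at_sub _ (T b)); first by move=> z Tz; exists b.
  pose x := ip (b' - b) (v b); pose y := ip (b' - b) (perp (v b)).
  have -> : b' = b + x *: v b + (y / creal sigma) *: (creal sigma *: perp (v b)).
    rewrite scalerA divfK ?creal_eq0 ?gt_eqF // -addrA -frame_eq // addrC subrK //.
  have xle : cnorm x <= sigma * (tau / 8) by apply: le_trans (ip_le _ v1) hb.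
  have yle : cnorm y <= sigma * (tau / 8).
    by apply: le_trans hb; apply: ip_le; rewrite enorm_perp.
  apply: (@pencil_hull _ _ _ _ k tau) => //.
  + move=> w w2; split; first exact: frame_neq0.
    by have /andP[] := frame_norm v1 s1 w2.
  + by rewrite /tau; lra.
  + apply: tube_neq0; last by lra.
    by rewrite -[X in _ + X]scale1r; apply: frame_neq0 => //; rewrite cnorm1; lra.
  + by move=> w wk z wz; exists w.
  + by apply: le_trans xle _; rewrite ler_piMl //; lra.
  + by rewrite cnormM cnormV cnorm_creal gtr0_norm // ler_pdivrMr // mulrC.
- have le : (size s)%:R * (e / (size s).+1%:R) <= e.
    by rewrite mulrCA ler_piMr ?(ltW e0) // ler_pdivrMr // mul1r ler_nat.
  apply: (thin_sub (fun z => id) le); apply: thin_seq => b bs.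
  by have [v1 _] := hv b (sL b bs); apply: hk => //; exact: Lh (sL b bs).
Qed.

End ThinFamilies.

(** * Slopes of lines that meet a thin set *)

Section PencilDirections.
Context {R : realType}.
Notation C := (Cplx R).
Notation V := 'rV[Cplx R]_2.
Implicit Types (z b v u p : V) (G U : set V) (e eta kap : R).

Lemma hull_at_neq0 G z : hull_at G z -> G !=set0.
Proof.
move=> h; apply: contrapT => /set0P/negP/negPn/eqP G0.
have := h _ (@polyfun_const R 0) (-1); rewrite cnorm0 G0 => /(_ (fun _ f => match f with end)).
by lra.
Qed.

Lemma slice_scale b v (a : C) : slice b (a *: v) `<=` slice b v.
Proof.
move=> z [z1 [t zt]]; split; first exact: z1.
by exists (t * a); rewrite zt scalerA.
Qed.

Lemma pencil_coordinates p eta (t w : C) z : enorm p = 1 ->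
  z = creal (1 - eta) *: p + t *: (perp p + w *: p) ->
  ip z p = creal (1 - eta) + t * w /\ ip z (perp p) = t.
Proof.
move=> p1 ->; have pp1 : enorm (perp p) = 1 by rewrite enorm_perp.
have [E1 E2] := (ip_self p1, ip_self pp1).
have [E3 E4] := (ip_perp_self p, ip_self_perp p).
by split; rewrite !ipD !ipZ ipD ipZ ?E1 ?E2 ?E3 ?E4; ring.
Qed.

(** Slices through [(1 - kap ^ 2) p] almost orthogonally to [p] are small. *)
Lemma pencil_slice_near p kap (w : C) z : enorm p = 1 -> 0 < kap <= 1/4 ->
  cnorm w <= kap ^+ 2 -> slice (creal (1 - kap ^+ 2) *: p) (perp p + w *: p) z ->
  enorm (z - p) <= 4 * kap.
Proof.
move=> p1 /andP[k0 k1] wk [z1 [t zt]].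
have [zp zq] := pencil_coordinates p1 zt; have pp1 : enorm (perp p) = 1 by rewrite enorm_perp.
have E1 := enorm_frame (ip z p) (ip z (perp p)) p1.
rewrite -frame_eq // z1 expr1n zp zq in E1.
have t0 := cnorm_ge0 t; have w0 := cnorm_ge0 w.
have k2 : kap ^+ 2 <= 1/16 by rewrite expr2; nra.
have k20 : 0 <= kap ^+ 2 by exact: sqr_ge0.
have t1 : cnorm t <= 1.
  rewrite -(@ler_pXn2r _ 2) // ?nnegrE ?cnorm_ge0 // expr1n E1 lerDr; exact: sqr_ge0.
have tw : cnorm t * cnorm w <= kap ^+ 2 by move: t0 t1 w0 wk k20; clear; nra.
have low : 1 - 2 * kap ^+ 2 <= cnorm (creal (1 - kap ^+ 2) + t * w).
  have := cnormD (creal (1 - kap ^+ 2) + t * w) (- (t * w)).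
  by rewrite addrK cnormN cnormM cnorm_creal ger0_norm; lra.
have t2 : cnorm t <= 2 * kap.
  rewrite -(@ler_pXn2r _ 2) // ?nnegrE ?cnorm_ge0 //; last by lra.
  move: (cnorm (creal _ + _)) low E1 => x low E1.
  have : (1 - 2 * kap ^+ 2) ^+ 2 <= x ^+ 2 by rewrite lerXn2r // nnegrE; lra.
  rewrite exprMn; move: E1 (kap ^+ 2) k2 k20; clear => E1 k *; nra.
have -> : z - p = t *: perp p + (t * w - creal (kap ^+ 2)) *: p.
  rewrite zt crealB creal1; apply: rV2P; rewrite !mxE /=; ring.
apply: le_trans (enormD _ _) _; rewrite !enormZ p1 pp1 !mulr1.
have := cnormD (t * w) (- creal (kap ^+ 2)).
rewrite cnormN cnormM cnorm_creal ger0_norm // => h.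
have : kap ^+ 2 <= kap by rewrite expr2; nra.
by move: h t2 tw; clear; lra.
Qed.

(** From a point at distance [eta] of the sphere, the slope of the line through a
    point of the sphere is a Lipschitz function of this point. *)
Lemma pencil_direction_lipschitz p eta (w w' : C) z z' : enorm p = 1 -> 0 < eta < 1 ->
  cnorm w <= 1 -> cnorm w' <= 1 ->
  slice (creal (1 - eta) *: p) (perp p + w *: p) z ->
  slice (creal (1 - eta) *: p) (perp p + w' *: p) z' ->
  eta * cnorm (w - w') <= 4 * enorm (z - z').
Proof.
move=> p1 /andP[e0 e1] w1 w1' [z1 [t zt]] [z1' [t' zt']].
have [zp zq] := pencil_coordinates p1 zt; have [zp' zq'] := pencil_coordinates p1 zt'.
have pp1 : enorm (perp p) = 1 by rewrite enorm_perp.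
have far : eta <= 2 * cnorm t.
  have h := enormD (creal (1 - eta) *: p) (t *: (perp p + w *: p)).
  rewrite -zt z1 !enormZ cnorm_creal p1 mulr1 ger0_norm in h; last by lra.
  have n2 : enorm (perp p + w *: p) <= 2.
    by have := enormD (perp p) (w *: p); rewrite enormZ pp1 p1 mulr1; lra.
  have : cnorm t * enorm (perp p + w *: p) <= cnorm t * 2.
    by rewrite ler_wpM2l // cnorm_ge0.
  by move: h; clear; lra.
have h1 : cnorm (t * w - t' * w') <= enorm (z - z').
  have -> : t * w - t' * w' = ip (z - z') p by rewrite ipB zp zp'; ring.
  exact: ip_le.
have h2 : cnorm (t - t') <= enorm (z - z').
  by rewrite -zq -zq' -ipB; exact: ip_le.
have : cnorm t * cnorm (w - w') <= 2 * enorm (z - z').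
  rewrite -cnormM; have -> : t * (w - w') = (t * w - t' * w') - (t - t') * w' by ring.
  apply: le_trans (cnormD _ _) _; rewrite cnormN cnormM.
  have : cnorm (t - t') * cnorm w' <= cnorm (t - t') by rewrite ler_piMr // cnorm_ge0.
  by move: h1 h2; clear; lra.
have : eta * cnorm (w - w') <= 2 * cnorm t * cnorm (w - w').
  by rewrite ler_wpM2r // cnorm_ge0.
by clear; lra.
Qed.

(** By [pencil_direction_lipschitz] a ball of radius [r] only blocks a disc of
    slopes of radius comparable to [r], and the hypothesis on the sum says that
    the total area of these discs is less than that of the square of admissible
    slopes. The balls are doubled, so that the slice avoids them with a margin. *)
Lemma unblocked_direction kap (B : seq (V * R)) p : 0 < kap <= 1/4 ->
  (forall q, q \in B -> 0 < q.2) -> \sum_(q <- B) q.2 ^+ 2 < kap ^+ 8 / 4 ^+ 5 ->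
  enorm p = 1 -> exists2 v, enorm v = 1 &
    forall z, slice (creal (1 - kap ^+ 2) *: p) v z ->
      enorm (z - p) <= 4 * kap /\ forall q, q \in B -> 2 * q.2 < enorm (z - q.1).
Proof.
move=> k01 B0 area p1; have /andP[k0 k1] := k01.
pose eta := kap ^+ 2; have eta0 : 0 < eta by rewrite exprn_gt0.
have eta1 : eta < 1 by rewrite /eta expr2; nra.
pose S w := slice (creal (1 - eta) *: p) (perp p + w *: p).
have cP (q : V * R) : exists w0 : C, forall w z, cnorm w <= 1 -> S w z ->
    enorm (z - q.1) <= 2 * q.2 -> cnorm (w - w0) <= 16 * q.2 / eta.
  have [[w0 [w01 [z0 [sz0 hz0]]]]|no] := pselect (exists w0 : C, cnorm w0 <= 1 /\
      exists z0, S w0 z0 /\ enorm (z0 - q.1) <= 2 * q.2).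
    exists w0 => w z w1 sz hz; rewrite ler_pdivlMr // mulrC.
    have e01 : 0 < eta < 1 by rewrite eta0.
    apply: le_trans (pencil_direction_lipschitz p1 e01 w1 w01 sz sz0) _.
    by have := enorm_triangle z q.1 z0; rewrite (enormB q.1); move: hz hz0; clear; lra.
  by exists 0 => w z w1 sz hz; case: no; exists w; split => //; exists z.
have [c hc] := choice cP.
pose s := [seq (c q, 16 * q.2 / eta) | q <- B].
have [|||w w2 hw] := @square_not_covered R s (eta / 2).
- by rewrite divr_gt0.
- by move=> x /mapP[q qB ->] /=; rewrite divr_gt0 // mulr_gt0 // B0.
- rewrite /s big_map /=.
  have -> : \sum_(q <- B) 4 * (16 * q.2 / eta) ^+ 2 =
     4 ^+ 5 / eta ^+ 2 * \sum_(q <- B) q.2 ^+ 2.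
    rewrite mulr_sumr; apply: eq_bigr => q _; rewrite expr_div_n exprMn; ring.
  have -> : 4 * (eta / 2) ^+ 2 = 4 ^+ 5 / eta ^+ 2 * (kap ^+ 8 / 4 ^+ 5).
    have -> : kap ^+ 8 = eta ^+ 4 by rewrite /eta -exprM.
    field; exact: lt0r_neq0.
  by rewrite ltr_pM2l // divr_gt0 ?exprn_gt0.
have we : cnorm w <= eta by move: w2; clear; lra.
have n0 : 0 < enorm (perp p + w *: p).
  have := pencil_coordinates (eta := 1) (t := 1) (w := w) p1 erefl.
  rewrite subrr scale1r creal0 scale0r add0r => -[_ h].
  have pp1 : enorm (perp p) = 1 by rewrite enorm_perp.
  by have := ip_le (perp p + w *: p) pp1; rewrite h cnorm1; lra.
exists ((creal (enorm (perp p + w *: p)))^-1 *: (perp p + w *: p)).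
  by rewrite enormZ cnormV cnorm_creal gtr0_norm // mulVf // gt_eqF.
move=> z /slice_scale sz; split; first exact: pencil_slice_near sz.
move=> q qB; rewrite ltNge; apply/negP => hz.
have := hw _ (map_f (fun q => (c q, 16 * q.2 / eta)) qB) => /=.
rewrite ltNge => /negP; apply; apply: (hc q _ z) => //.
by move: we eta1; clear; lra.
Qed.

End PencilDirections.

(** * Refinement into small disjoint pieces *)

Section Refinement.
Context {R : realType}.
Notation C := (Cplx R).
Notation V := 'rV[Cplx R]_2.
Implicit Types (z b v u p : V) (G U K : set V) (e eta kap : R).

Lemma seq_lower_bound (T : eqType) (s : seq T) (F : T -> R) :
  (forall q, q \in s -> 0 < F q) -> exists2 r, 0 < r & forall q, q \in s -> r <= F q.
Proof.
elim: s => [|q s IH] h; first by exists 1.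
have [|r r0 hr] := IH; first by move=> x xs; apply: h; rewrite inE xs orbT.
exists (Num.min r (F q)); first by rewrite lt_min r0 h ?mem_head.
move=> x; rewrite inE => /predU1P[->|/hr]; rewrite ge_min ?lexx ?orbT //.
by move=> ->.
Qed.

(** The pieces are chosen one after the other. The earlier ones form a thin set,
    so every point [(1 - kap ^ 2) p] still sees the complement of this set in the
    ball prescribed for the next piece, and [thin_family] applies. *)
Lemma disjoint_pieces K (d kap e : R) (ps : seq V) : K `<=` unit_sphere R ->
  0 < d -> 0 < kap <= 1/4 -> 4 * kap <= d / 2 -> 0 < e ->
  (size ps)%:R * e < kap ^+ 8 / 4 ^+ 5 ->
  exists G : nat -> set V, exists2 D : R, 0 < D &
    [/\ forall i, (i < size ps)%N -> [/\ G i `<=` unit_sphere R,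
          forall z, G i z -> enorm (z - nth 0 ps i) < 2 * d &
          forall p, K p -> enorm (p - nth 0 ps i) <= d ->
            hull_at (G i) (creal (1 - kap ^+ 2) *: p)],
      forall i j z z', (i < j < size ps)%N -> G i z -> G j z' -> D <= enorm (z - z') &
      thin [set z | exists2 i, (i < size ps)%N & G i z] ((size ps)%:R * e)].
Proof.
move=> KS d0 k01 kd e0; have /andP[k0 k1] := k01; elim/last_ind: ps => [|ps p IH] sz.
  exists (fun=> set0), 1 => //; split => //.
  have -> : (size ([::] : seq V))%:R * e = 0 by rewrite mul0r.
  by apply: thin_sub (@thin0 R); [move=> z [] | exact: lexx].
rewrite size_rcons in sz.
have sz' : (size ps)%:R * e < kap ^+ 8 / 4 ^+ 5.
  by move: sz; rewrite -natr1 mulrDl; move: e0; clear; lra.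
have [G [D D0 [hG sep th]]] := IH sz'; set n := size ps in hG sep th sz sz'.
have [B [B0 cov sm]] := th; have [rho rho0 hrho] := seq_lower_bound B0.
pose U := [set z | enorm (z - p) < 2 * d /\ forall i, (i < n)%N -> ~ G i z].
pose L := [set b | exists2 q, K q /\ enorm (q - p) <= d & b = creal (1 - kap ^+ 2) *: q].
pose delta := Num.min (d / 2) rho.
have delta0 : 0 < delta by rewrite lt_min rho0 andbT divr_gt0.
have k20 : 0 < kap ^+ 2 by rewrite exprn_gt0.
have k21 : kap ^+ 2 <= 1 by rewrite expr2; move: k0 k1; clear; nra.
have Lh b : L b -> enorm b <= 1 - kap ^+ 2.
  move=> [q [/KS q1 _] ->]; rewrite enormZ q1 mulr1 cnorm_creal ger0_norm //.
  by rewrite subr_ge0.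
have Ls b : L b -> sees U delta b.
  move=> [q [Kq qp] ->].
  have [v v1 hv] := unblocked_direction k01 B0 (le_lt_trans sm sz') (KS _ Kq).
  exists v => // z /hv[zq zB] z'; rewrite lt_min => /andP[zd zr]; split.
    have := enorm_triangle z' z p; have := enorm_triangle z q p.
    by move: kd zq qp zd; clear; lra.
  move=> i ilt Giz'; have [|q' q'B hq'] := cov z'; first by exists i.
  have := zB _ q'B; have := hrho _ q'B; have := enorm_triangle z z' q'.1.
  by rewrite (enormB z z'); move: hq' zr; clear; lra.
have h1 : 1 - kap ^+ 2 < 1 by rewrite gtrBl.
have [Gn GnS [dn dn0 [mn hn tn]]] := thin_family h1 delta0 e0 Lh Ls.
pose G' i := if i == n then Gn else G i.
have G'n : G' n = Gn by rewrite /G' eqxx.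
have G'lt i : (i < n)%N -> G' i = G i by move=> lt; rewrite /G' ltn_eqF.
exists G', (Num.min D dn); first by rewrite lt_min D0.
rewrite size_rcons -/n; split.
- move=> i; rewrite ltnS leq_eqVlt => /predU1P[->|lt].
    rewrite G'n nth_rcons -/n ltnn eqxx; split => // [z Gz|q Kq qp].
      have [|//] := mn z Gz z; first by rewrite subrr enorm0.
    by apply: hn; exists q.
  by rewrite G'lt // nth_rcons -/n lt; exact: hG.
- move=> i j z z' /andP[ij]; rewrite ltnS leq_eqVlt => /predU1P[jn|jn].
    rewrite jn in ij *; rewrite G'n (G'lt _ ij) => Gz Gz'; rewrite ge_min.
    apply/orP; right; rewrite leNgt; apply/negP => lt.
    by have [_ /(_ i ij)] := mn z' Gz' z lt.
  rewrite (G'lt _ jn) (G'lt _ (ltn_trans ij jn)) => Gz Gz'.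
  by rewrite ge_min (sep i j) ?ij.
- rewrite -natr1 mulrDl mul1r; apply: (thin_sub _ (lexx _) (thin_setU th tn)).
  move=> z [ i ]; rewrite /= ltnS leq_eqVlt => /predU1P[->|lt].
    by rewrite G'n; right.
  by rewrite G'lt //; left; exists i.
Qed.

(** One step of the construction, from the scale [d] to the scale [d']. In the
    last condition [A] is the piece of [x], and there is another piece within
    [e] of [x]. *)
Definition refines (e : R) (K : set V) (d : R) (K' : set V) (d' : R) : Prop :=
  [/\ 0 < d' <= d / 2,
      forall z', K' z' -> exists2 z, K z & enorm (z' - z) <= d / 2,
      forall z, K z -> exists2 z', K' z' & enorm (z' - z) <= d / 2 &
      forall x, K' x -> exists2 A : set V, A x & [/\
        forall y, K' y -> A y -> enorm (x - y) <= e,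
        forall y y', K' y -> A y -> K' y' -> ~ A y' -> 4 * d' < enorm (y - y') &
        exists2 y, K' y & ~ A y /\ enorm (x - y) <= e]].

(** The radius [beta'] is not fixed: each refinement decreases it, but keeps it
    above [beta]. *)
Definition fills (beta : R) (K : set V) : Prop := K `<=` unit_sphere R /\
  exists2 beta' : R, beta < beta' & forall z, enorm z <= beta' -> hull_at K z.

(** Pieces are chosen in balls of radius comparable to [r] that cover [K]; a
    polynomial bounded on all of them is bounded on [(1 - kap ^ 2) K], and the
    hull commutes with homotheties. *)
Lemma refinement_exists (beta e d : R) K : 0 < beta -> 0 < e -> 0 < d ->
  fills beta K -> exists K' d', fills beta K' /\ refines e K d K' d'.
Proof.
move=> b0 e0 d0 [KS [beta' bb hull]].
have [r [r0 rd re]] : exists r : R, [/\ 0 < r, 8 * r <= d & 8 * r <= e].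
  exists (Num.min d e / 8); have md : Num.min d e <= d by rewrite ge_min lexx.
  have me : Num.min d e <= e by rewrite ge_min lexx orbT.
  have m0 : 0 < Num.min d e by rewrite lt_min d0.
  by split; lra.
have b'0 : 0 < beta' by exact: lt_trans bb.
(* The last bound on [kap] keeps the radius above [beta]. *)
pose kap := Num.min (Num.min (1/4) (r / 8)) ((beta' - beta) / (2 * beta')).
have k0 : 0 < kap.
  rewrite !lt_min; apply/andP; split; first by apply/andP; split; lra.
  by rewrite divr_gt0 ?mulr_gt0 // subr_gt0.
have k1 : kap <= 1/4 by rewrite !ge_min lexx.
have k2 : 4 * kap <= r / 2.
  have : kap <= r / 8 by rewrite !ge_min lexx !orbT.
  by lra.
have k3 : beta < (1 - kap ^+ 2) * beta'.
  have : kap <= (beta' - beta) / (2 * beta') by rewrite !ge_min lexx !orbT.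
  rewrite ler_pdivlMr ?mulr_gt0 // => h.
  have : kap ^+ 2 * beta' <= kap * beta'.
    by rewrite ler_pM2r // expr2 ler_piMl //; [exact: ltW | lra].
  by move: h bb; clear; lra.
have k01 : 0 < kap <= 1/4 by rewrite k0.
have [|s sK hs] := @subset_net R K r r0; first by move=> z /KS ->.
(* Every centre is listed twice, so that each piece has a neighbour. *)
pose ps := s ++ s; pose M := size s.
have sps : size ps = (M + M)%N by rewrite size_cat.
pose e1 := kap ^+ 8 / 4 ^+ 5 / (size ps).+1%:R.
have e10 : 0 < e1 by rewrite !divr_gt0 // exprn_gt0.
have e1s : (size ps)%:R * e1 < kap ^+ 8 / 4 ^+ 5.
  rewrite /e1 mulrCA gtr_pMr ?divr_gt0 ?exprn_gt0 //.
  by rewrite ltr_pdivrMr // mul1r ltr_nat.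
have [G [D D0 [hG sep _]]] := disjoint_pieces KS r0 k01 k2 e10 e1s.
have psK i : (i < size ps)%N -> K (nth 0 ps i).
  by move=> /(mem_nth 0); rewrite mem_cat orbb; exact: sK.
have Gn0 i : (i < size ps)%N -> G i !=set0.
  move=> lt; have [_ _ h] := hG i lt.
  apply: (@hull_at_neq0 _ _ (creal (1 - kap ^+ 2) *: nth 0 ps i)).
  by apply: h; [exact: psK | rewrite subrr enorm0 ltW].
have near z : K z -> exists2 i, (i < size ps)%N & enorm (z - nth 0 ps i) <= r.
  move=> /hs[p ps' zp]; exists (index p s).
    by rewrite sps ltn_addr // index_mem.
  by rewrite nth_cat index_mem ps' nth_index.
have sep' i j z z' : (i < size ps)%N -> (j < size ps)%N -> i != j ->
    G i z -> G j z' -> D <= enorm (z - z').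
  move=> il jl; rewrite neq_ltn => /orP[ij|ji] Gz Gz'.
    by apply: (sep i j) => //; rewrite ij.
  by rewrite enormB; apply: (sep j i) => //; rewrite ji.
pose K' := [set z | exists2 i, (i < size ps)%N & G i z].
exists K', (Num.min (d / 2) (D / 8)); split.
  split; first by move=> z [i il Gz]; have [h _ _] := hG i il; exact: h.
  exists ((1 - kap ^+ 2) * beta') => // z hz f pf Mf hM.
  have cc : 0 < 1 - kap ^+ 2 by rewrite subr_gt0 expr2; move: k0 k1; clear; nra.
  pose c := creal (1 - kap ^+ 2); have c0 : c != 0 by rewrite creal_eq0 gt_eqF.
  have -> : z = 0 + c *: (c^-1 *: z) by rewrite add0r scalerA divff // scale1r.
  apply: (hull (c^-1 *: z) _ (fun z => f (0 + c *: z))) => //.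
  - by rewrite enormZ cnormV cnorm_creal gtr0_norm // mulrC ler_pdivrMr // mulrC.
  - exact: polyfun_affine.
  move=> w Kw; rewrite add0r; have [i il wi] := near w Kw.
  have [_ _ h] := hG i il; apply: (h w Kw wi f pf) => y Gy.
  by apply: hM; exists i.
split.
- by rewrite lt_min !divr_gt0 //= ge_min lexx.
- move=> z' [i il Gz]; exists (nth 0 ps i); first exact: psK.
  by have [_ h _] := hG i il; have := h _ Gz; lra.
- move=> z Kz; have [i il zi] := near z Kz; have [z' Gz'] := Gn0 i il.
  exists z'; first by exists i.
  have [_ h _] := hG i il; have := h _ Gz'.
  by have := enorm_triangle z' (nth 0 ps i) z; rewrite (enormB (nth 0 ps i)); lra.
move=> x [i il Gx]; exists (G i) => //.
have small j y : (j < size ps)%N -> nth 0 ps j = nth 0 ps i -> G j y -> enorm (x - y) <= e.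
  move=> jl ji Gy; have [_ hi _] := hG i il; have [_ hj _] := hG j jl.
  have := hi _ Gx; have := hj _ Gy; rewrite ji.
  by have := enorm_triangle x (nth 0 ps i) y; rewrite (enormB (nth 0 ps i)); lra.
split.
- by move=> y _; exact: small.
- move=> y y' _ Gy [j jl Gy'] nGy'.
  have ij : i != j by apply/eqP => ij; apply: nGy'; rewrite ij.
  have := sep' _ _ _ _ il jl ij Gy Gy'; have : Num.min (d / 2) (D / 8) <= D / 8.
    by rewrite ge_min lexx orbT.
  by lra.
have iMM : (i < M + M)%N by rewrite -sps.
pose j := if (i < M)%N then (i + M)%N else (i - M)%N.
have jl : (j < size ps)%N.
  by rewrite sps /j; move: iMM; clear; case: (ltnP i M); lia.
have ji : nth 0 ps j = nth 0 ps i.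
  rewrite /j !nth_cat -/M; case: (ltnP i M) => iM.
    by rewrite ltnNge leq_addl /= addnK.
  by rewrite ifT //; move: iMM iM; clear; lia.
have ij : i != j by rewrite /j; move: iMM; clear; case: (ltnP i M); lia.
have [y Gy] := Gn0 j jl; exists y; first by exists j.
split; last exact: (small j).
by move=> Gy'; have := sep' _ _ _ _ il jl ij Gy' Gy; rewrite subrr enorm0; lra.
Qed.

End Refinement.

(** * Topology of the plane and compactness of the sphere *)

Section PlaneTopology.
Context {R : realType}.
Notation C := (Cplx R).
Notation V := 'rV[Cplx R]_2.
Implicit Types (z b v u p : V) (G U K : set V).

Lemma Cplx_norm (x : C) : `|x| = creal (cnorm x).
Proof. by case: x. Qed.

Lemma creal_lt (a b : R) : (creal a < creal b) = (a < b).
Proof. exact: ltcR. Qed.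

Lemma Cplx_pos (e : C) : 0 < e -> exists2 r : R, 0 < r & e = creal r.
Proof.
case: e => a b; rewrite ltcE /= => /andP[/eqP b0 a0]; exists a => //.
by rewrite b0.
Qed.

Lemma nbhs_cnormP (x : C) (A : set C) :
  nbhs x A <-> exists2 r : R, 0 < r & forall y, cnorm (y - x) < r -> A y.
Proof.
split=> [/nbhs_ballP[e /= /Cplx_pos[r r0 ->] sub]|[r r0 sub]].
  exists r => // y yx; apply: sub; rewrite /ball /= /ball_ Cplx_norm creal_lt.
  by rewrite cnormB.
apply/nbhs_ballP; exists (creal r) => /=; first by rewrite -creal0 creal_lt.
move=> y; rewrite /ball /= /ball_ Cplx_norm creal_lt cnormB; exact: sub.
Qed.

Lemma nbhs_enormP z (A : set V) :
  nbhs z A <-> exists2 r : R, 0 < r & forall w, enorm (w - z) < r -> A w.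
Proof.
split=> [/nbhs_ballP[e /= /Cplx_pos[r r0 ->] sub]|[r r0 sub]].
  exists r => // w wz; apply: sub; split; first by rewrite -creal0 creal_lt.
  move=> i j; rewrite /ball /= /ball_ Cplx_norm creal_lt cnormB ord1.
  by have := coord_le (w - z) j; rewrite !mxE => h; exact: le_lt_trans wz.
apply/nbhs_ballP; exists (creal (r / 2)) => /=.
  by rewrite -creal0 creal_lt divr_gt0.
move=> w [_ wz]; apply: sub; apply: le_lt_trans (enorm_le_sum _) _.
have := wz 0 0; have := wz 0 1; rewrite /ball /= /ball_ !Cplx_norm !creal_lt.
by rewrite !(cnormB (z _ _)) !mxE; lra.
Qed.

Lemma open_enormP U :
  open U <-> forall z, U z -> exists2 r : R, 0 < r & forall w, enorm (w - z) < r -> U w.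
Proof.
rewrite openE; split=> [h z /h /nbhs_enormP //|h z /h ?]; exact/nbhs_enormP.
Qed.

Lemma closed_enormP U :
  closed U <-> forall z, (forall r : R, 0 < r -> exists2 w, U w & enorm (w - z) < r) -> U z.
Proof.
split=> [cl z hz|h z cz].
  apply: cl => B /nbhs_enormP[r r0 sub]; have [w Uw wz] := hz r r0.
  by exists w; split => //; exact: sub.
apply: h => r r0; have [|w [Uw wz]] := cz [set w | enorm (w - z) < r].
  by apply/nbhs_enormP; exists r.
by exists w.
Qed.

Lemma cnorm_continuous : continuous (@cnorm R : C -> R).
Proof.
move=> x A /nbhs_ballP[e /= e0 sub].
apply/nbhs_cnormP; exists e => // y yx; apply: sub; apply: le_lt_trans yx.
have := cnormD (x - y) y; have := cnormD (y - x) x; rewrite !subrK (cnormB x).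
by rewrite ler_norml => ? ?; apply/andP; split; lra.
Qed.

Lemma polyfun_continuous (f : V -> C) : polyfun f -> continuous f.
Proof.
elim=> {f} [c|j|f g _ IHf _ IHg|f g _ IHf _ IHg] z.
- exact: cst_continuous.
- exact: coord_continuous.
- exact: cvgD (IHf z) (IHg z).
- exact: cvgM (IHf z) (IHg z).
Qed.

Lemma cnorm_polyfun_continuous (f : V -> C) : polyfun f ->
  continuous (fun z => cnorm (f z)).
Proof.
by move=> pf z; apply: continuous_comp; [exact: polyfun_continuous | exact: cnorm_continuous].
Qed.

Lemma unit_sphere_compact : compact (unit_sphere R).
Proof.
pose h (x : R * R) : C := (x.1 +i* x.2)%C.
have hc : continuous h.
  move=> [a b] A /nbhs_cnormP[r r0 sub] /=.
  apply/nbhs_ballP; exists (r / 2) => /=; first by rewrite divr_gt0.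
  move=> [c d] [/= ac bd]; apply: sub; apply: le_lt_trans (cnorm_le_sum _) _.
  move: ac bd; rewrite /ball /= /h /= (distrC a) (distrC b); lra.
have box : compact (h @` (`[(-1 : R), 1] `*` `[(-1 : R), 1])).
  apply: continuous_compact; first exact: continuous_subspaceT.
  by apply: compact_setX; exact: segment_compact.
apply: (subclosed_compact _ (@rV_compact C 2 (fun=> _) (fun=> box))).
  apply/closed_enormP => z hz; apply/eqP; rewrite eq_le; apply/andP; split.
    apply/ler_addgt0Pr => e e0; have [w w1 wz] := hz e e0.
    by have := enormD w (z - w); rewrite addrC subrK w1 enormB; lra.
  apply/ler_addgt0Pr => e e0; have [w w1 wz] := hz e e0.
  by have := enormD z (w - z); rewrite addrC subrK w1; lra.
move=> z z1 i; have := coord_le z i; rewrite z1 => zi.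
exists (complex.Re (z 0 i), complex.Im (z 0 i)).
  split; rewrite /= in_itv /= -ler_norml; apply: le_trans zi; [exact: Re_le | exact: Im_le].
by rewrite /h /=; case: (z _ _).
Qed.

Lemma nested_compact (S : set V) (F : nat -> set V) : compact S ->
  (forall n, closed (F n)) -> (forall n, F n.+1 `<=` F n) ->
  (forall n, exists2 z, S z & F n z) -> exists2 z, S z & forall n, F n z.
Proof.
move=> cS clF dF nF.
have /choice[u hu] : forall n, exists z, S z /\ F n z.
  by move=> n; have [z] := nF n; exists z.
have mono n m : (n <= m)%N -> F m `<=` F n.
  elim: m => [|m IH]; first by rewrite leqn0 => /eqP ->.
  rewrite leq_eqVlt => /predU1P[->//|/IH h]; exact: subset_trans (dF m) h.
have uS : (u @ \oo) S by exists 0%N => // n _; exact: (hu n).1.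
have [z [Sz cz]] := cS _ _ uS.
exists z => // n; apply: clF => B zB; apply: cz => //.
by exists n => // m /= nm; apply: (mono _ _ nm); exact: (hu m).2.
Qed.

End PlaneTopology.

(** * Characterization of Cantor sets *)

Section CantorCharacterization.
Context {R : realType}.

Definition split_by_opens (T : topologicalType) (A : set T) : Prop :=
  forall x y, A x -> A y -> x <> y -> exists U U' : set T,
    [/\ open U, open U', U x, U' y & A `<=` U `|` U' /\ A `&` U `&` U' = set0].

Definition no_isolated_point (T : topologicalType) (A : set T) : Prop :=
  forall x (U : set T), A x -> nbhs x U -> exists y, [/\ A y, U y & y <> x].

(** Brouwer's characterization of the Cantor space, transferred from types to
    subsets of a metric space. *)
Lemma cantor_space_homeo (T : pseudoMetricType R) (A : set T) : hausdorff_space T ->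
  A !=set0 -> compact A -> split_by_opens A -> no_isolated_point A ->
  exists (f : cantor_space -> T) (g : T -> cantor_space),
    [/\ continuous f, {within A, continuous g}, forall c, A (f c),
        forall c, g (f c) = c & forall x, A x -> f (g x) = x].
Proof.
move=> hT [a0 Aa0] cA sA pA.
pose a0' : set_type A := exist _ a0 (mem_set Aa0).
have inj_val : injective (@set_val T A).
  by move=> [x px] [y py] /= xy; apply: eq_exist.
have val_cts : continuous (@set_val T A) by exact: initial_continuous.
have cpt : compact [set: set_type A].
  move=> F FF _; pose G := set_val @ F.
  have GA : G A.
    by rewrite /G /=; apply: (filterS _ filterT) => x _; exact: set_valP.
  have [p [Ap cp]] := cA G _ GA.
  exists (exist _ p (mem_set Ap)); split => // B N FB [W [[W' oW' <-] /= Wp WN]].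
  have GB : G (set_val @` B).
    change (F (set_val @^-1` (@set_val T A @` B))).
    by apply: filterS FB => x Bx; exists x.
  have pW : nbhs p W' by apply: open_nbhs_nbhs; split => //; exact: Wp.
  have [q [[x Bx <-] W'q]] := cp _ _ GB pW.
  by exists x; split => //; exact: WN.
have hsd : hausdorff_space (set_type A).
  move=> x y cxy; apply: inj_val; apply: hT => B D Bx Dy.
  have [z [Bz Dz]] := cxy _ _ (val_cts x _ Bx) (val_cts y _ Dy).
  by exists (set_val z).
have zero : zero_dimensional (set_type A).
  move=> x y xy; have [|||U [U' [oU oU' Ux U'y [cov dis]]]] := sA (set_val x) (set_val y).
  - exact: set_valP.
  - exact: set_valP.
  - by move=> /inj_val /eqP; rewrite (negbTE xy).
  have disj (z : set_type A) : U (set_val z) -> U' (set_val z) -> False.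
    move=> Uz U'z; rewrite -[False]/(set0 (set_val z)) -dis.
    by split => //; split => //; exact: set_valP.
  exists (set_val @^-1` U); split => //.
  - split; first by apply: open_comp => // ? _; exact: val_cts.
    have -> : set_val @^-1` U = ~` (@set_val T A @^-1` U').
      apply/seteqP; split => [z /= Uz U'z|z /= nU'z]; first exact: (disj z).
      by have [|/nU'z] := cov _ (set_valP z).
    by apply: open_closedC; apply: open_comp => // ? _; exact: val_cts.
  - by move=> Uy; exact: (disj y).
have perf : perfect_set [set: set_type A].
  apply/perfectTP_ex => U [W oW <-] [x /= Wx].
  have [|y [Ay Wy yx]] := pA _ W (set_valP x); first by apply: open_nbhs_nbhs; split.
  exists x, (exist _ y (mem_set Ay)); split => //.
  by apply/eqP => xy; apply: yx; rewrite xy.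
pose T' : pseudoPMetricType R := HB.pack (set_type A) (isPointed.Build (set_type A) a0').
have [f [fc fcl]] := @homeomorphism_cantor_like R T' (And4 perf cpt hsd zero).
have [finv fK finvK] : bijective (f : cantor_space -> set_type A) by exact: bijTT.
have finvc : continuous finv.
  apply/continuous_closedP => B clB.
  have -> : finv @^-1` B = f @` B; last exact: fcl.
  by apply/seteqP; split => [x /= Bx|x /= [c Bc <-]]; [exists (finv x) | rewrite fK].
pose g (t : T) : cantor_space :=
  if pselect (A t) is left h then finv (exist _ t (mem_set h)) else point.
have gE (x : set_type A) : g (set_val x) = finv x.
  rewrite /g; case: pselect => [h|]; last by case; exact: set_valP.
  by congr finv; apply: inj_val.
exists (fun c => set_val (f c : set_type A)), g; split.
- by move=> c; apply: continuous_comp; [exact: fc | exact: val_cts].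
- apply/subspace_sigL_continuousP.
  by have -> : sigL A g = finv by apply/funext => x; exact: gE.
- by move=> c; exact: set_valP.
- by move=> c; rewrite gE fK.
- move=> t At; have -> : t = set_val (exist _ t (mem_set At) : set_type A) by [].
  by rewrite gE finvK.
Qed.

Lemma homeomorphic_cantor (T T' : pseudoMetricType R) (A : set T) (A' : set T') :
  hausdorff_space T -> A !=set0 -> compact A -> split_by_opens A ->
  no_isolated_point A ->
  hausdorff_space T' -> A' !=set0 -> compact A' -> split_by_opens A' ->
  no_isolated_point A' -> homeomorphic A A'.
Proof.
move=> h1 n1 c1 s1 p1 h2 n2 c2 s2 p2.
have [f [g [fc gc fA gf fg]]] := cantor_space_homeo h1 n1 c1 s1 p1.
have [f' [g' [fc' gc' fA' gf' fg']]] := cantor_space_homeo h2 n2 c2 s2 p2.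
exists (f' \o g), (f \o g'); split.
- by move=> x; exact: (@continuous_comp (subspace A) _ _ g f' x (gc x) (fc' _)).
- by move=> x; exact: (@continuous_comp (subspace A') _ _ g' f x (gc' x) (fc _)).
- by move=> x _; exact: fA'.
- by move=> x _; exact: fA.
- by split => x Ax /=; [rewrite gf' fg | rewrite gf fg'].
Qed.

End CantorCharacterization.

(** * The middle-third set *)

Section MiddleThirds.
Context {R : realType}.
Implicit Types (x y c : R).
Notation stage := (@cantor_stage R).
Notation thirds := (middle_third_cantor R).

Lemma stage_bounds n x : stage n x -> 0 <= x <= 1.
Proof.
elim: n x => [x|n IH x]; first by rewrite /= in_itv.
by move=> [] [y /IH /andP[y0 y1] <-]; apply/andP; split; lra.
Qed.

Lemma stageS_left n x : x <= 1/2 -> stage n.+1 x <-> stage n (3 * x).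
Proof.
move=> x2; split=> [[] [y sy yx]|sx].
- by rewrite -yx (_ : 3 * (y / 3) = y) //; lra.
- by have /andP[y0 _] := stage_bounds sy; lra.
- by left; exists (3 * x) => //; lra.
Qed.

Lemma stageS_right n x : 1/2 <= x -> stage n.+1 x <-> stage n (3 * x - 2).
Proof.
move=> x2; split=> [[] [y sy yx]|sx].
- by have /andP[_ y1] := stage_bounds sy; lra.
- by rewrite -yx (_ : 3 * ((y + 2) / 3) - 2 = y) //; lra.
- by right; exists (3 * x - 2) => //; lra.
Qed.

Lemma stage_decreasing n : stage n.+1 `<=` stage n.
Proof.
elim: n => [x h|n IH x].
  by rewrite /= in_itv; exact: (stage_bounds h).
by move=> [] [y sy <-]; [left|right]; exists y => //; exact: IH.
Qed.

Lemma thirds_bounds x : thirds x -> 0 <= x <= 1.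
Proof. by move=> h; exact: stage_bounds (h 0%N I). Qed.

Lemma thirds_left x : x <= 1/2 -> thirds x <-> thirds (3 * x).
Proof.
move=> x2; split=> h n _; first by apply/(stageS_left n x2); exact: h.
by apply: stage_decreasing; apply/(stageS_left n x2); exact: h.
Qed.

Lemma thirds_right x : 1/2 <= x -> thirds x <-> thirds (3 * x - 2).
Proof.
move=> x2; split=> h n _; first by apply/(stageS_right n x2); exact: h.
by apply: stage_decreasing; apply/(stageS_right n x2); exact: h.
Qed.

Lemma thirds0 : thirds 0.
Proof.
move=> n _; elim: n => [|n IH]; first by rewrite /= in_itv /= lexx ler01.
by apply/stageS_left; rewrite ?mulr0 //; lra.
Qed.

Lemma thirds1 : thirds 1.
Proof.
move=> n _; elim: n => [|n IH]; first by rewrite /= in_itv /= lexx ler01.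
by apply/stageS_right; [lra | rewrite (_ : 3 * 1 - 2 = 1) //; ring].
Qed.

(** By self-similarity: points on different sides of [1/2] are separated by
    [1/2], and a homothety of ratio 3 reduces the other cases to [n - 1]. *)
Lemma thirds_gap n x y : thirds x -> thirds y -> x < y -> 1 < 3 ^+ n * (y - x) ->
  exists2 c, x < c < y & ~ thirds c.
Proof.
elim: n x y => [|n IH] x y tx ty xy.
  have /andP[x0 _] := thirds_bounds tx; have /andP[_ y1] := thirds_bounds ty.
  by rewrite expr0; lra.
rewrite exprSr -mulrA => big.
have [y2|y2] := leP y (1/2).
  have x2 : x <= 1/2 by lra.
  have [||||c /andP[c1 c2] nc] := IH (3 * x) (3 * y).
  - exact/(thirds_left x2).
  - exact/(thirds_left y2).
  - by lra.
  - by rewrite -mulrBr.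
  exists (c / 3); first by apply/andP; split; lra.
  have c3 : c / 3 <= 1/2 by lra.
  by move=> /(thirds_left c3); rewrite (_ : 3 * (c / 3) = c) //; lra.
have [x2|x2] := leP (1/2) x.
  have y2' := ltW y2.
  have [||||c /andP[c1 c2] nc] := IH (3 * x - 2) (3 * y - 2).
  - exact/(thirds_right x2).
  - exact/(thirds_right y2').
  - by lra.
  - by rewrite (_ : 3 * y - 2 - (3 * x - 2) = 3 * (y - x)) //; ring.
  exists ((c + 2) / 3); first by apply/andP; split; lra.
  have c3 : 1/2 <= (c + 2) / 3 by lra.
  by move=> /(thirds_right c3); rewrite (_ : 3 * ((c + 2) / 3) - 2 = c) //; lra.
exists (1/2); first by apply/andP; split; lra.
move=> h; have /thirds_left [/(_ h) /thirds_bounds + _] : 1/2 <= 1/2 :> R by [].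
by lra.
Qed.

Lemma thirds_near n x : thirds x -> exists y, [/\ thirds y, 3 ^+ n * `|y - x| <= 1 & y <> x].
Proof.
elim: n x => [|n IH] x tx.
  have /andP[x0 x1] := thirds_bounds tx.
  have [->|xn0] := eqVneq x 0.
    exists 1; split; first exact: thirds1.
      by rewrite expr0 mul1r subr0 normr1.
    by apply/eqP; rewrite oner_eq0.
  exists 0; split; first exact: thirds0.
    by rewrite expr0 mul1r sub0r normrN ger0_norm.
  by move=> x0'; rewrite -x0' eqxx in xn0.
have scale y z : y - x = z / 3 -> 3 ^+ n.+1 * `|y - x| = 3 ^+ n * `|z|.
  by move=> ->; rewrite exprSr normrM [`|3^-1|]ger0_norm //; field.
have [x2|x2] := leP x (1/2).
  have [y [ty yx nyx]] := IH _ ((thirds_left x2).1 tx).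
  have /andP[_ y1] := thirds_bounds ty.
  exists (y / 3); split.
  - have y2 : y / 3 <= 1/2 by lra.
    by apply/(thirds_left y2); rewrite (_ : 3 * (y / 3) = y) //; lra.
  - by rewrite (scale _ (y - 3 * x)) //; lra.
  - by move=> h; apply: nyx; lra.
have [y [ty yx nyx]] := IH _ ((thirds_right (ltW x2)).1 tx).
have /andP[y0 _] := thirds_bounds ty.
exists ((y + 2) / 3); split.
- have y2 : 1/2 <= (y + 2) / 3 by lra.
  by apply/(thirds_right y2); rewrite (_ : 3 * ((y + 2) / 3) - 2 = y) //; lra.
- by rewrite (scale _ (y - (3 * x - 2))) //; lra.
- by move=> h; apply: nyx; lra.
Qed.

Lemma power3_unbounded (r : R) : 0 < r -> exists n, 1 < 3 ^+ n * r.
Proof.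
move=> r0; exists (Num.truncn r^-1).+1.
rewrite -ltr_pdivrMr // mul1r; apply: lt_trans (truncnS_gt _) _.
by rewrite -natrX ltr_nat ltn_expl.
Qed.

Lemma thirds_compact : compact thirds.
Proof.
apply: (subclosed_compact _ (@segment_compact R 0 1)).
  apply: closed_bigI => n _; elim: n => [|n IH]; first exact: itv_closed.
  have affine (a b : R) : a != 0 -> closed [set (x + b) / a | x in stage n].
    move=> a0; have -> : [set (x + b) / a | x in stage n] = (fun y => a * y - b) @^-1` stage n.
      apply/seteqP; split=> [y [x sx <-] /=|y /= sy].
        by rewrite mulrC divfK // addrK.
      by exists (a * y - b) => //; rewrite subrK mulrC mulKf.
    apply: preimage_closed => // y _; apply: cvgB; last exact: cst_continuous.
    by apply: cvgM; [exact: cst_continuous | exact: cvg_id].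
  apply: closedU; last by apply: affine; rewrite pnatr_eq0.
  have := affine 3 0; under eq_imagel do rewrite addr0.
  by apply; rewrite pnatr_eq0.
by move=> x /thirds_bounds; rewrite /= in_itv.
Qed.

Lemma thirds_split : split_by_opens thirds.
Proof.
have sep x y : thirds x -> thirds y -> x < y -> exists2 c, x < c < y & ~ thirds c.
  move=> tx ty xy; have [|n hn] := @power3_unbounded (y - x); first by lra.
  exact: thirds_gap hn.
move=> x y tx ty /eqP; rewrite neq_lt => /orP[xy|xy].
- have [c /andP[c1 c2] nc] := sep _ _ tx ty xy.
  exists [set z | z < c], [set z | c < z]; split; [exact: open_lt|exact: open_gt|by []|by []|split].
    move=> z tz; have [zc|zc|zc] := ltgtP z c; [by left|by right|].
    by case: nc; rewrite -zc.
  by apply/seteqP; split => // z [[_ /= h1] h2]; move: (lt_trans h1 h2); rewrite ltxx.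
- have [c /andP[c1 c2] nc] := sep _ _ ty tx xy.
  exists [set z | c < z], [set z | z < c]; split; [exact: open_gt|exact: open_lt|by []|by []|split].
    move=> z tz; have [zc|zc|zc] := ltgtP z c; [by right|by left|].
    by case: nc; rewrite -zc.
  by apply/seteqP; split => // z [[_ /= h1] h2]; move: (lt_trans h1 h2); rewrite ltxx.
Qed.

Lemma thirds_perfect : no_isolated_point thirds.
Proof.
move=> x U tx /nbhs_ballP[e /= e0 sub].
have [n hn] := power3_unbounded e0; have [y [ty yx nyx]] := thirds_near n tx.
exists y; split => //; apply: sub; rewrite /ball /= distrC.
by rewrite -(ltr_pM2l (exprn_gt0 n (ltr0n R 3))); apply: le_lt_trans hn.
Qed.

End MiddleThirds.

(** * A metric on the plane indexed by the reals *)

(** The plane with its own topology, but with a metric indexed by the real field: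
    the metric of a space over [Cplx R] is indexed by [Cplx R]. *)
Definition real_plane (R : realType) : Type := 'rV[Cplx R]_2.

Section RealPlane.
Context {R : realType}.
Notation V := 'rV[Cplx R]_2.

HB.instance Definition _ := Uniform.on (real_plane R).

Let rball (z : real_plane R) (r : R) : set (real_plane R) := ball (z : V) (creal r).

Let rball_center z r : 0 < r -> rball z r z.
Proof. by move=> r0; apply: ballxx; rewrite -creal0 creal_lt. Qed.

Let rball_sym z w r : rball z r w -> rball w r z.
Proof. exact: ball_sym. Qed.

Let rball_triangle z w x r r' : rball z r w -> rball w r' x -> rball z (r + r') x.
Proof. by rewrite /rball crealD; exact: ball_triangle. Qed.

Let rball_entourage : entourage = entourage_ rball.
Proof.
rewrite -[LHS]/(@entourage V) -entourage_ballE; apply/seteqP; split => A /=.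
  move=> [e /= /Cplx_pos[r r0 ->] sub]; by exists r.
move=> [r /= r0 sub]; exists (creal r) => //=; by rewrite -creal0 creal_lt.
Qed.

HB.instance Definition _ := Uniform_isPseudoMetric.Build R (real_plane R)
  rball_center rball_sym rball_triangle rball_entourage.

End RealPlane.

(** * The limit set *)

Section LimitSet.
Context {R : realType}.
Notation C := (Cplx R).
Notation V := 'rV[Cplx R]_2.
Implicit Types (z b v u p : V) (G U K : set V).

(** The slack [e] makes the thickening closed although [K] need not be. *)
Definition thickening K (d : R) : set V :=
  [set z | forall e, 0 < e -> exists2 g, K g & enorm (z - g) < d + e].

Lemma thickening_closed K d : closed (thickening K d).
Proof.
apply/closed_enormP => z hz e e0; have e20 : 0 < e / 2 by rewrite divr_gt0.
have [w wK zw] := hz _ e20; have [g Kg wg] := wK _ e20.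
by exists g => //; have := enorm_triangle z w g; rewrite (enormB z w); lra.
Qed.

Lemma sub_thickening K d : 0 <= d -> K `<=` thickening K d.
Proof. by move=> d0 z Kz e e0; exists z => //; rewrite subrr enorm0; lra. Qed.

Lemma enorm_ball_closed p (r : R) : closed [set z | enorm (z - p) <= r].
Proof.
apply/closed_enormP => z hz /=; apply/ler_addgt0Pr => e e0; have [w wp wz] := hz e e0.
by have := enorm_triangle z w p; rewrite (enormB z w); move: wp => /=; lra.
Qed.

Lemma sphere_fills (beta : R) : 0 < beta < 1 -> fills beta (unit_sphere R).
Proof.
move=> /andP[b0 b1]; split => //; exists ((1 + beta) / 2); first by lra.
move=> z hz f pf M hM.
pose v : V := \row_(j < 2) 1.
have v0 : v != 0 by apply/eqP => /rowP /(_ 0) /eqP; rewrite !mxE oner_eq0.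
have z1 : enorm z < 1 by lra.
have := @slice_max R z v f M pf v0 z1 _ 0; rewrite scale0r addr0; apply; last exact: ltW.
by move=> w [w1 _]; exact: hM.
Qed.

Lemma refining_sequence (beta : R) : 0 < beta < 1 ->
  exists (K : nat -> set V) (d : nat -> R), d 0%N = 1 /\ forall n,
    fills beta (K n) /\ refines ((1 / 2) ^+ n) (K n) (d n) (K n.+1) (d n.+1).
Proof.
move=> b01; have /andP[b0 _] := b01.
have /choice[F hF] : forall x : nat * (set V * R), exists y : set V * R,
    0 < x.2.2 -> fills beta x.2.1 ->
    fills beta y.1 /\ refines ((1 / 2) ^+ x.1) x.2.1 x.2.2 y.1 y.2.
  move=> [n [K d]] /=; have [d0|nd] := pselect (0 < d); last by exists (K, d).
  have [fK|nf] := pselect (fills beta K); last by exists (K, d).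
  have e0 : 0 < (1 / 2 : R) ^+ n by rewrite exprn_gt0 // divr_gt0.
  have [K' [d' h]] := refinement_exists b0 e0 d0 fK.
  by exists (K', d').
pose s := fix s n : set V * R :=
  if n is m.+1 then F (m, s m) else (unit_sphere R, 1).
have hs n : 0 < (s n).2 /\ fills beta (s n).1.
  elim: n => [|n [s0 fs]]; first by split => //; exact: sphere_fills.
  by have [fs' [/andP[h _] _ _ _]] := hF (n, s n) s0 fs.
exists (fun n => (s n).1), (fun n => (s n).2); split => // n.
have [s0 fs] := hs n; split => //.
by have [_ h] := hF (n, s n) s0 fs.
Qed.

Section Limit.
Context (beta : R) (K : nat -> set V) (d : nat -> R).
Context (beta01 : 0 < beta < 1).
Context (d0 : d 0%N = 1).
Context (fillK : forall n, fills beta (K n)).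
Context (refK : forall n,
  refines ((1 / 2) ^+ n) (K n) (d n) (K n.+1) (d n.+1)).

Let E : set V := [set z | forall n, thickening (K n) (d n) z].

Let d_gt0 n : 0 < d n.
Proof. by case: n => [|n]; [rewrite d0 | have [/andP[]] := refK n]. Qed.

Let d_half n : d n.+1 <= d n / 2.
Proof. by have [/andP[]] := refK n. Qed.

Let d_le n : d n <= (1 / 2) ^+ n.
Proof.
elim: n => [|n IH]; first by rewrite d0 expr0.
by have := d_half n; rewrite exprS; lra.
Qed.

Let small (r : R) : 0 < r -> exists n, (1 / 2) ^+ n < r.
Proof.
move=> r0; have r20 : 0 < r / 2 by rewrite divr_gt0.
have [n hn] := small_power 1 r20; exists n.
by have := hn n (leqnn n); rewrite mul1r; lra.
Qed.

Let thickening_decreasing n : thickening (K n.+1) (d n.+1) `<=` thickening (K n) (d n).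
Proof.
move=> z hz e e0; have [g' Kg' zg'] := hz e e0; have [_ + _ _] := refK n.
move=> /(_ _ Kg')[g Kg gg']; exists g => //.
by have := enorm_triangle z g' g; have := d_half n; lra.
Qed.

Let E_near n x : E x -> exists2 g, K n g & enorm (x - g) < 2 * d n.
Proof.
by move=> Ex; have [g Kg xg] := Ex n _ (d_gt0 n); exists g => //; lra.
Qed.

Lemma limit_sphere : E `<=` unit_sphere R.
Proof.
move=> x Ex; apply/eqP; rewrite eq_le; apply/andP; split;
  apply/ler_addgt0Pr => e e0; have e20 : 0 < e / 2 by rewrite divr_gt0.
- have [n hn] := small e20; have [g Kg xg] := E_near n Ex.
  have [KS _] := fillK n; have g1 : enorm g = 1 := KS _ Kg.
  by have := enormD g (x - g); have := d_le n; rewrite addrC subrK g1; lra.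
- have [n hn] := small e20; have [g Kg xg] := E_near n Ex.
  have [KS _] := fillK n; have g1 : enorm g = 1 := KS _ Kg.
  by have := enormD x (g - x); have := d_le n; rewrite addrC subrK g1 (enormB g); lra.
Qed.

Lemma limit_compact : compact E.
Proof.
apply: (subclosed_compact _ unit_sphere_compact limit_sphere).
have -> : E = \bigcap_n thickening (K n) (d n).
  by apply/seteqP; split => [x h n _|x h n]; exact: h.
by apply: closed_bigI => n _; exact: thickening_closed.
Qed.

Let chain n g m : K n g ->
  exists2 g', K (n + m)%N g' & enorm (g' - g) <= d n - d (n + m)%N.
Proof.
move=> Kg; elim: m => [|m [g' Kg' gg']].
  by rewrite addn0; exists g; rewrite // !subrr enorm0.
have [_ _ + _] := refK (n + m)%N => /(_ _ Kg')[g'' Kg'' h].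
exists g''; rewrite addnS //.
by have := enorm_triangle g'' g' g; have := d_half (n + m)%N; lra.
Qed.

(** The successive approximations contain a chain of points starting at [g] whose
    steps add up to at most [d n]. *)
Lemma limit_near n g : K n g -> exists2 y, E y & enorm (y - g) <= d n.
Proof.
move=> Kg.
pose F m := thickening (K (n + m)%N) (d (n + m)%N) `&` [set z | enorm (z - g) <= d n].
have [|||y Sy hy] := @nested_compact R _ F unit_sphere_compact.
- by move=> m; apply: closedI; [exact: thickening_closed | exact: enorm_ball_closed].
- by move=> m z [h1 h2]; split => //; rewrite addnS in h1; exact: thickening_decreasing.
- move=> m; have [g' Kg' h] := chain m Kg; have [KS _] := fillK (n + m)%N.
  exists g'; first exact: KS.
  split; first by apply: sub_thickening => //; exact: ltW.
  by rewrite /=; have := d_gt0 (n + m)%N; lra.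
exists y; last by have [] := hy 0%N.
have mono m k : (m <= k)%N -> thickening (K k) (d k) `<=` thickening (K m) (d m).
  elim: k => [|k IH]; first by rewrite leqn0 => /eqP ->.
  rewrite leq_eqVlt => /predU1P[->//|/IH h].
  exact: subset_trans (@thickening_decreasing k) h.
by move=> m; apply: (mono m (n + m)%N); [rewrite leq_addl | exact: (hy m).1].
Qed.

Let K_neq0 n : K n !=set0.
Proof.
have [_ [b' bb' h]] := fillK n; have /andP[b0 _] := beta01.
by apply: (@hull_at_neq0 _ _ 0); apply: h; rewrite enorm0; lra.
Qed.

Lemma limit_neq0 : E !=set0.
Proof. by have [g /limit_near[y Ey _]] := K_neq0 0%N; exists y. Qed.

Lemma limit_split (x y : V) : E x -> E y -> x <> y -> exists U U' : set V,
  [/\ open U, open U', U x, U' y & E `<=` U `|` U' /\ E `&` U `&` U' = set0].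
Proof.
move=> Ex Ey xy.
have xy0 : 0 < enorm (x - y) by rewrite lt_def enorm_ge0 enorm_eq0 subr_eq0 andbT; apply/eqP.
have r0 : 0 < enorm (x - y) / 8 by rewrite divr_gt0.
have [n hn] := small r0; have dn := d_le n; have dn' := d_half n.
have [g Kg xg] := E_near n.+1 Ex.
have [_ _ _ /(_ g Kg)[A Ag [Asmall Asep _]]] := refK n.
have opn (P : set V) : open [set z | exists2 g', P g' & enorm (z - g') < 2 * d n.+1].
  apply/open_enormP => z [g' Pg' zg']; exists (2 * d n.+1 - enorm (z - g')); first by lra.
  by move=> w wz; exists g' => //; have := enorm_triangle w z g'; lra.
pose P := K n.+1 `&` A; pose P' := K n.+1 `&` ~` A.
exists [set z | exists2 g', P g' & enorm (z - g') < 2 * d n.+1],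
  [set z | exists2 g', P' g' & enorm (z - g') < 2 * d n.+1]; split.
- exact: opn.
- exact: opn.
- by exists g.
- have [g' Kg' yg'] := E_near n.+1 Ey; exists g' => //; split => // Ag'.
  have := Asmall _ Kg' Ag'; have := enorm_triangle x g y; have := enorm_triangle g g' y.
  by rewrite (enormB g' y); lra.
split.
  move=> z Ez; have [g' Kg' zg'] := E_near n.+1 Ez.
  by have [Ag'|nAg'] := pselect (A g'); [left|right]; exists g'.
apply/seteqP; split => // z [[_ [g1 [Kg1 Ag1] zg1]] [g2 [Kg2 Ag2] zg2]].
have := Asep _ _ Kg1 Ag1 Kg2 Ag2; have := enorm_triangle g1 z g2.
by rewrite (enormB g1 z); lra.
Qed.

Lemma limit_perfect (x : V) (U : set V) : E x -> nbhs x U ->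
  exists y, [/\ E y, U y & y <> x].
Proof.
move=> Ex /nbhs_enormP[r r0 sub]; have r40 : 0 < r / 4 by rewrite divr_gt0.
have [n hn] := small r40; have dn := d_le n; have dn' := d_half n.
have dp := d_gt0 n.+1; have [g Kg xg] := Ex n.+1 _ dp.
have [_ _ _ /(_ g Kg)[A Ag [_ Asep [g' Kg' [nA gg']]]]] := refK n.
have sep := Asep _ _ Kg Ag Kg' nA; have [y Ey yg'] := limit_near Kg'.
exists y; split => //.
  apply: sub; have := enorm_triangle y g' x; have := enorm_triangle g' g x.
  by rewrite (enormB g' g) (enormB g x); lra.
move=> yx; rewrite yx in yg'.
have := enorm_triangle g x g'; rewrite (enormB g x); lra.
Qed.

(** If [z] violated the estimate for the limit set, the approximations would
    contain points with large values of the polynomial, and so would the limit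
    set by compactness of the sphere. *)
Lemma limit_hull z : enorm z <= beta -> poly_hull E z.
Proof.
move=> zb p; pose f := peval p; have pf : polyfun f by exact: polyfun_peval.
have cf := cnorm_polyfun_continuous pf.
have [c /set_mem Ec cmax] :=
  compact_EVT_max limit_neq0 limit_compact (continuous_subspaceT cf).
exists (cnorm (f c)); first split.
- by exists c.
- by move=> _ [w Ew <-]; apply: cmax; exact: mem_set.
rewrite -[X in X <= _]/(cnorm (f z)) leNgt; apply/negP => lt.
pose M := (cnorm (f c) + cnorm (f z)) / 2.
pose F n := thickening (K n) (d n) `&` [set w | M <= cnorm (f w)].
have [|||y Sy hy] := @nested_compact R _ F unit_sphere_compact.
- move=> n; apply: closedI; first exact: thickening_closed.
  have -> : [set w | M <= cnorm (f w)] = (fun w => cnorm (f w)) @^-1` [set x | M <= x] by [].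
  by apply: preimage_closed => [w _|]; [exact: cf | exact: closed_ge].
- by move=> n w [h1 h2]; split => //; exact: thickening_decreasing.
- move=> n; have [KS [b' bb' hull]] := fillK n.
  apply: contrapT => no; have := hull z _ f pf M.
  have -> : enorm z <= b' by lra.
  move=> /(_ isT); apply/not_implyP; split.
    move=> w Kw; rewrite leNgt; apply/negP => Mw; apply: no; exists w; first exact: KS.
    split; last exact: ltW.
    by apply: sub_thickening => //; exact: ltW.
  by rewrite /M; lra.
have Ey : E y by move=> n; have [] := hy n.
have := cmax y (mem_set Ey); have [_ /=] := hy 0%N.
by rewrite /M; lra.
Qed.

Lemma limit_cantor_set : cantor_set E.
Proof.
split; first exact: limit_compact.
apply: (@homeomorphic_cantor R (real_plane R) R E (middle_third_cantor R)).
- move=> x y cxy; apply: contrapT => xy.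
  have xy0 : 0 < enorm ((x : V) - y).
    by rewrite lt_def enorm_ge0 enorm_eq0 subr_eq0 andbT; apply/eqP.
  have r0 : 0 < enorm ((x : V) - y) / 2 by rewrite divr_gt0.
  have [||w [xw yw]] := cxy [set w : V | enorm (w - x) < enorm ((x : V) - y) / 2]
     [set w : V | enorm (w - y) < enorm ((x : V) - y) / 2].
  + by apply/(nbhs_enormP (x : V)); exists (enorm ((x : V) - y) / 2).
  + by apply/(nbhs_enormP (y : V)); exists (enorm ((x : V) - y) / 2).
  by have := enorm_triangle (x : V) w y; rewrite (enormB (x : V) w); move: xw yw => /=; lra.
- exact: limit_neq0.
- exact: limit_compact.
- exact: limit_split.
- exact: limit_perfect.
- exact: Rhausdorff.
- by exists 0; exact: thirds0.
- exact: thirds_compact.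
- exact: thirds_split.
- exact: thirds_perfect.
Qed.

End Limit.

End LimitSet.

Theorem mainTheorem1 (R : realType) (beta : R) (hbeta : 0 < beta < 1) :
  exists E : set 'rV[Cplx R]_2,
    [/\ cantor_set E, E `<=` unit_sphere R &
        closed_eball beta `<=` poly_hull E].
Proof.
have [K [d [d0 hKd]]] := refining_sequence hbeta.
have fK n : fills beta (K n) by have [] := hKd n.
have rK n : refines ((1 / 2) ^+ n) (K n) (d n) (K n.+1) (d n.+1) by have [] := hKd n.
eexists; split.
- exact: limit_cantor_set hbeta d0 fK rK.
- exact: limit_sphere d0 fK rK.
- by move=> z; exact: limit_hull hbeta d0 fK rK _.
Qed.
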